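(* Let $p$ be a prime with $p\equiv 3$ or $7\pmod{10}$, and let $n>0$ with $(n,10)=1$. When $T_{p}(D_{n})$ is written as a sum of distinct $D_{k}$, each $k$ satisfies $k<n$.
   Context: All power series are in $\mathbb{Z}/2[[x]]$. Let $F=\sum_{n\ \mathrm{odd},\,n>0}x^{n^{2}}$, $G=F(x^{5})$, $D=\sum_{n>0,\ (n,10)=1}x^{n^{2}}$. For $k>0$, $(k,10)=1$, define $D_{1}=D$, $D_{3}=D^{8}/G$, $D_{7}=D^{2}G$, $D_{9}=D^{4}G$, $D_{k+10}=G^{2}D_{k}$. These are linearly independent, and for primes $p\ne 2,5$, $T_{p}(D_{n})$ lies in their span, where $T_{p}(\sum c_{n}x^{n})=\sum c_{pn}x^{n}+\sum c_{n}x^{pn}$. *)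

(* Defs.v *)
From mathcomp Require Import all_boot.
Set Implicit Arguments. Unset Strict Implicit. Unset Printing Implicit Defensive.

(* Power series in Z/2[[x]] are represented by their coefficient
   functions nat -> bool; addition is addb (xor). *)
Definition series := nat -> bool.

Definition sadd (f g : series) : series := fun n => addb (f n) (g n).

Definition smul (f g : series) : series :=
  fun n => \big[addb/false]_(i < n.+1) (f i && g (n - i)).

Definition sone : series := fun n => n == 0.
Definition szero : series := fun _ => false.

Definition spow (f : series) (k : nat) : series := iter k (smul f) sone.

Definition F : series :=
  fun N => [exists m : 'I_N.+1, odd m && (m * m == N)].

Definition G : series := fun N => (5 %| N) && F (N %/ 5).

Definition D : series :=
  fun N => [exists m : 'I_N.+1, (0 < m) && coprime m 10 && (m * m == N)].

(* Division by G.  Since G = x^5 + (higher terms), for h the series q with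
   q * G = h (valid whenever h has no terms of degree < 5) is given by
   q_n = h_(n+5) + sum_(i<n) q_i G_(n+5-i).  divG_coefs h n lists q_0..q_(n-1). *)
Fixpoint divG_coefs (h : series) (n : nat) : seq bool :=
  match n with
  | 0 => [::]
  | n'.+1 =>
      let s := divG_coefs h n' in
      rcons s (addb (h (n' + 5))
                    (\big[addb/false]_(i < n') (nth false s i && G (n' + 5 - i))))
  end.

Definition divG (h : series) : series := fun n => nth false (divG_coefs h n.+1) n.

Definition Dbase (r : nat) : series :=
  if r == 1 then D
  else if r == 3 then divG (spow D 8)
  else if r == 7 then smul (spow D 2) G
  else if r == 9 then smul (spow D 4) G
  else szero.

Definition Dk (k : nat) : series := smul (spow G (2 * (k %/ 10))) (Dbase (k %% 10)).

Definition Tp (p : nat) (f : series) : series :=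
  fun n => addb (f (p * n)) ((p %| n) && f (n %/ p)).

Definition sumD (S : seq nat) : series :=
  fun N => \big[addb/false]_(k <- S) Dk k N.

(* Main.v *)
Require Import Defs.
From mathcomp Require Import all_boot.
From HB Require Import structures.
From mathcomp Require Import all_algebra all_fingroup all_solvable all_field.
From mathcomp Require Import boolp classical_sets.
From mathcomp Require Import zify ring.
Set Implicit Arguments. Unset Strict Implicit. Unset Printing Implicit Defensive.
Import GRing.Theory.
Local Open Scope classical_set_scope.
Local Open Scope ring_scope.

(* Write G1 = G(x^p) and D1 = D(x^p).  The series T_p(D_n), evaluated at x^p, is
   the sum of D_n(x^(p^2)) and of the conjugates D_n(z^j x), with z a primitive p-th
   root of unity in a finite field k of characteristic 2.  Everything is compared at
   a place of the fraction field of k[[x]] where D1 has a pole.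

   The upper bound comes from p-isogenies of the Tate curve y^2 + xy = x^3 + F(q),
   with q = x^p.  The functions Y_j = sum_(m in Z) z(q^m x^j), z(u) = 1/(u + 1/u),
   are the abscissas of its p-torsion points, and the duplication formula
   Y_2j Y_j^2 = Y_j^4 + F(q) forces Y_j^4 to be no larger than max(1, F(q)) at every
   place.  Since F(x) + F(q) = S + S^2 with S = sum_(0 < j < p/2) Y_j, the series F(x)
   and F(q) have poles of the same order at any place where F(q) has one.
   Applied at level x^5, this shows that the conjugates of G, and G1, have the same
   pole order.  For p = 5 the same formulas give the level 5 modular equation
   (F + G)^6 = F G, hence D^16 = G^4 D^4 + G^3 D, which bounds the conjugates of D.

   The lower bound comes from the same equation: normalising the pole order of G1 to
   6, D1 has order 2 and D1^3 + G1 has order 3, so that the pole order of a sum of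
   distinct D_k(x^p), with all k in {1, 9} or all in {3, 7} modulo 10, can be read
   off the largest k.  Finally, T_p exchanges these two classes because the exponents
   of D_k are +-1 modulo 5 in the first one and +-2 in the second. *)

(** * Formal power series over a field *)

Definition ps (k : fieldType) : Type := nat -> k.

Section PowerSeries.
Variable k : fieldType.
Implicit Types f g h : ps k.

HB.instance Definition _ := gen_eqMixin (ps k).
HB.instance Definition _ := gen_choiceMixin (ps k).

Definition ps_trunc (N : nat) f : {poly k} := \poly_(i < N) f i.
Definition ps_add f g : ps k := fun n => f n + g n.
Definition ps_opp f : ps k := fun n => - f n.
Definition ps_mul f g : ps k := fun n => \sum_(i < n.+1) f i * g (n - i)%N.
Definition ps_const (c : k) : ps k := fun n => if n == 0%N then c else 0.

Fact ps_addA : associative ps_add.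
Proof. by move=> f g h; apply: funext => n; rewrite /ps_add addrA. Qed.
Fact ps_addC : commutative ps_add.
Proof. by move=> f g; apply: funext => n; rewrite /ps_add addrC. Qed.
Fact ps_add0 : left_id (ps_const 0) ps_add.
Proof. by move=> f; apply: funext => n; rewrite /ps_add /ps_const if_same add0r. Qed.
Fact ps_addN : left_inverse (ps_const 0) ps_opp ps_add.
Proof.
by move=> f; apply: funext => n; rewrite /ps_add /ps_const if_same addNr.
Qed.

HB.instance Definition _ := GRing.isZmodule.Build (ps k)
  ps_addA ps_addC ps_add0 ps_addN.

Lemma coef_ps_trunc N f i : (ps_trunc N f)`_i = if (i < N)%N then f i else 0.
Proof. by rewrite coef_poly. Qed.

(** A coefficient of a product only sees truncations, so associativity and commutativity are
    inherited from [{poly k}]. *)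
Lemma ps_mul_trunc N f g n :
  (n < N)%N -> ps_mul f g n = (ps_trunc N f * ps_trunc N g)`_n.
Proof.
move=> lt_nN; rewrite coefM; apply: eq_bigr => i _.
have le_in : (i <= n)%N by rewrite -ltnS.
by rewrite !coef_ps_trunc (leq_ltn_trans le_in) // (leq_ltn_trans (leq_subr _ _)).
Qed.

Lemma coefM_eq_low N (p q p' q' : {poly k}) n :
  (n < N)%N -> (forall i, (i < N)%N -> p`_i = p'`_i) ->
  (forall i, (i < N)%N -> q`_i = q'`_i) -> (p * q)`_n = (p' * q')`_n.
Proof.
move=> lt_nN pp' qq'; rewrite !coefM; apply: eq_bigr => i _.
by rewrite pp' ?qq' //; have := ltn_ord i; lia.
Qed.

Fact ps_mulA : associative ps_mul.
Proof.
move=> f g h; apply: funext => n; rewrite !(@ps_mul_trunc n.+1) //.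
rewrite (@coefM_eq_low n.+1 _ _ (ps_trunc n.+1 f)
  (ps_trunc n.+1 g * ps_trunc n.+1 h)) //; last first.
  by move=> i lt_in; rewrite coef_ps_trunc lt_in (@ps_mul_trunc n.+1).
rewrite mulrA; apply: (@coefM_eq_low n.+1) => // i lt_in.
by rewrite coef_ps_trunc lt_in (@ps_mul_trunc n.+1).
Qed.

Fact ps_mulC : commutative ps_mul.
Proof.
by move=> f g; apply: funext => n; rewrite !(@ps_mul_trunc n.+1) // mulrC.
Qed.

Fact ps_mul1 : left_id (ps_const 1) ps_mul.
Proof.
move=> f; apply: funext => n; rewrite /ps_mul big_ord_recl /= subn0 mul1r.
by rewrite big1 ?addr0 // => i _; rewrite /= mul0r.
Qed.

Fact ps_mulDl : left_distributive ps_mul ps_add.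
Proof.
move=> f g h; apply: funext => n; rewrite /ps_mul /ps_add -big_split /=.
by apply: eq_bigr => i _; rewrite mulrDl.
Qed.

Fact ps_1neq0 : ps_const 1 != 0.
Proof.
by apply/eqP => /(congr1 (fun f : ps k => f 0%N)) /eqP; rewrite /= oner_eq0.
Qed.

HB.instance Definition _ := GRing.Zmodule_isComNzRing.Build (ps k)
  ps_mulA ps_mulC ps_mul1 ps_mulDl ps_1neq0.

Lemma psD f g n : (f + g) n = f n + g n. Proof. by []. Qed.
Lemma psN f n : (- f) n = - f n. Proof. by []. Qed.
Lemma psM f g n : (f * g) n = \sum_(i < n.+1) f i * g (n - i)%N.
Proof. by []. Qed.
Lemma ps1E n : (1 : ps k) n = (n == 0%N)%:R.
Proof. by rewrite [LHS]/(ps_const 1 n) /ps_const; case: eqP. Qed.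
Lemma ps0E n : (0 : ps k) n = 0.
Proof. by rewrite [LHS]/(ps_const 0 n) /ps_const if_same. Qed.
Lemma psP f g : (forall n, f n = g n) -> f = g.
Proof. exact: funext. Qed.

Lemma ps_sumE (I : Type) (r : seq I) (P : pred I) (F : I -> ps k) n :
  (\sum_(i <- r | P i) F i) n = \sum_(i <- r | P i) F i n.
Proof.
by elim/big_rec2: _ => [|i x y _ <-]; [exact: ps0E|].
Qed.

(** Inverses are chosen classically; the unit structure leads to the integral domain whose fraction
    field carries the places. *)
Definition ps_unit : pred (ps k) := fun f => `[< exists g, g * f = 1 >].
Definition ps_inv f : ps k :=
  if pselect (exists g, g * f = 1) is left e then sval (cid e) else f.

Fact ps_mulVr : {in ps_unit, left_inverse 1 ps_inv *%R}.
Proof.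
move=> f /asboolP ex_g; rewrite /ps_inv; case: pselect => // e.
exact: (svalP (cid e)).
Qed.
Fact ps_unitP f g : g * f = 1 -> ps_unit f.
Proof. by move=> gf1; apply/asboolP; exists g. Qed.
Fact ps_inv_out : {in [predC ps_unit], ps_inv =1 id}.
Proof.
by move=> f /asboolPn nex; rewrite /ps_inv; case: pselect => // /nex.
Qed.

HB.instance Definition _ := GRing.ComNzRing_hasMulInverse.Build (ps k)
  ps_mulVr ps_unitP ps_inv_out.

Lemma ps_neq0 f : f != 0 -> exists2 n, f n != 0 & forall i, (i < n)%N -> f i = 0.
Proof.
move=> f_neq0; have ex_n : exists n, f n != 0.
  apply/not_existsP => f0; case/eqP: f_neq0; apply: psP => n; rewrite ps0E.
  by apply/eqP/negPn/negP => /f0.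
case: (ex_minnP ex_n) => n fn_neq0 n_min; exists n => // i lt_in.
by apply/eqP; apply: contraTT lt_in => /n_min; rewrite -leqNgt.
Qed.

Fact ps_integral f g : f * g = 0 -> (f == 0) || (g == 0).
Proof.
move=> fg0; apply/norP => -[/ps_neq0[m fm fm_min] /ps_neq0[n gn gn_min]].
have /(congr1 (fun h : ps k => h (m + n)%N)) := fg0; rewrite ps0E psM.
have lt_m : (m < (m + n).+1)%N by lia.
rewrite (bigD1 (Ordinal lt_m)) //= addKn big1 ?addr0 => [/eqP|i].
  by rewrite mulf_eq0 (negbTE fm) (negbTE gn).
rewrite -val_eqE /= => neq_im; case: (ltngtP i m) => [lt_im|lt_mi|].
- by rewrite fm_min ?mul0r.
- by rewrite gn_min ?mulr0 //; have := ltn_ord i; lia.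
- by move/eqP; rewrite (negbTE neq_im).
Qed.

HB.instance Definition _ := GRing.ComUnitRing_isIntegral.Build (ps k) ps_integral.

Definition psX (n : nat) : ps k := fun i => (i == n)%:R.

Lemma psXM n f i : (psX n * f) i = if (i < n)%N then 0 else f (i - n)%N.
Proof.
rewrite psM; case: ltnP => [lt_in|le_ni].
  apply: big1 => j _; rewrite /psX; case: eqP => [E|_]; last by rewrite mul0r.
  by have := ltn_ord j; lia.
have lt_n : (n < i.+1)%N by [].
rewrite (bigD1 (Ordinal lt_n)) //= /psX eqxx mul1r big1 ?addr0 // => j.
by rewrite -val_eqE /= => /negbTE ->; rewrite mul0r.
Qed.

Lemma psXD m n : psX m * psX n = psX (m + n).
Proof.
apply: psP => i; rewrite psXM /psX; case: ltnP => [lt_im|le_mi].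
  by case: eqP => // E; lia.
by congr (nat_of_bool _)%:R; apply/eqP/eqP; lia.
Qed.

(** The substitutions [x -> x^e] and [x -> a x]; the second gives the conjugates when [a] is a p-th
    root of unity. *)
Definition ps_subst (e : nat) f : ps k :=
  fun n => if (e %| n)%N then f (n %/ e)%N else 0.
Definition ps_scale (a : k) f : ps k := fun n => a ^+ n * f n.

Fact ps_scale_zmod a : zmod_morphism (ps_scale a).
Proof. by move=> f g; apply: psP => n; rewrite /ps_scale !psD !psN mulrBr. Qed.
Fact ps_scale_monoid a : monoid_morphism (ps_scale a).
Proof.
split; first by apply: psP => -[|n]; rewrite /ps_scale ps1E ?expr0 ?mul1r ?mulr0.
move=> f g; apply: psP => n; rewrite /ps_scale !psM mulr_sumr.
apply: eq_bigr => i _; rewrite mulrACA -exprD; congr (_ ^+ _ * _).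
by have := ltn_ord i; lia.
Qed.
HB.instance Definition _ a :=
  GRing.isZmodMorphism.Build (ps k) (ps k) (ps_scale a) (ps_scale_zmod a).
HB.instance Definition _ a :=
  GRing.isMonoidMorphism.Build (ps k) (ps k) (ps_scale a) (ps_scale_monoid a).

Lemma ps_subst_zmod e : zmod_morphism (ps_subst e).
Proof.
move=> f g; apply: psP => n; rewrite /ps_subst !psD !psN.
case: ifP => _; [by [] | by rewrite subr0].
Qed.
HB.instance Definition _ e :=
  GRing.isZmodMorphism.Build (ps k) (ps k) (ps_subst e) (ps_subst_zmod e).
Lemma ps_subst_monoid e : (0 < e)%N -> monoid_morphism (ps_subst e).
Proof.
move=> e_gt0; split.
  apply: psP => n; rewrite /ps_subst !ps1E; case: dvdnP => [[m ->]|ndv].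
    by rewrite mulnK // muln_eq0 (gtn_eqF e_gt0) orbF.
  by case: eqP => // n0; case: ndv; exists 0%N.
move=> f g; apply: psP => n; pose N := n.+1.
have substE h i : (i < N)%N -> (ps_trunc N (ps_subst e h))`_i = (ps_trunc N h \Po 'X^e)`_i.
  move=> lt_iN; rewrite coef_comp_poly_Xn // coef_ps_trunc lt_iN /ps_subst.
  by case: ifP => // _; rewrite coef_ps_trunc (leq_ltn_trans (leq_div _ _)).
rewrite [RHS](@ps_mul_trunc N) // (@coefM_eq_low N _ _ _ _ n _ (substE f) (substE g)) //.
rewrite -comp_polyM coef_comp_poly_Xn // /ps_subst; case: ifP => // _.
by rewrite -ps_mul_trunc // (leq_ltn_trans (leq_div _ _)).
Qed.

Lemma ps_substMn a b f : (0 < a)%N -> (0 < b)%N -> ps_subst a (ps_subst b f) = ps_subst (a * b) f.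
Proof.
move=> a0 b0; apply: psP => n; rewrite /ps_subst.
case: (boolP (a %| n)%N) => [/dvdnP[m ->]|ndv].
  by rewrite mulnK // (mulnC m) dvdn_pmul2l // divnMA mulKn.
by case: ifP => // /(dvdn_trans (dvdn_mulr b (dvdnn a))); rewrite (negbTE ndv).
Qed.

(** * Congruence of series modulo [x^N] *)

Definition eqm (N : nat) f g := forall n, (n < N)%N -> f n = g n.

Lemma eqmP f g : (forall N, eqm N f g) -> f = g.
Proof. by move=> fg; apply: psP => n; apply: (fg n.+1). Qed.
Lemma eqm_refl N f : eqm N f f. Proof. by []. Qed.
Lemma eqm_sym N f g : eqm N f g -> eqm N g f.
Proof. by move=> fg n /fg. Qed.
Lemma eqm_trans N f g h : eqm N f g -> eqm N g h -> eqm N f h.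
Proof. by move=> fg gh n n_lt; rewrite fg ?gh. Qed.
Lemma eqmD N f g f' g' : eqm N f f' -> eqm N g g' -> eqm N (f + g) (f' + g').
Proof. by move=> ff gg n n_lt; rewrite !psD ff ?gg. Qed.
Lemma eqmM N f g f' g' : eqm N f f' -> eqm N g g' -> eqm N (f * g) (f' * g').
Proof.
move=> ff gg n n_lt; rewrite !psM; apply: eq_bigr => i _.
by rewrite ff ?gg //; have := ltn_ord i; lia.
Qed.
Lemma eqm_sum N (I : Type) (r : seq I) (P : pred I) (F F' : I -> ps k) :
  (forall i, P i -> eqm N (F i) (F' i)) ->
  eqm N (\sum_(i <- r | P i) F i) (\sum_(i <- r | P i) F' i).
Proof.
by move=> FF' n n_lt; rewrite !ps_sumE; apply: eq_bigr => i /FF'; apply.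
Qed.
Lemma eqm_subst N e f g : (0 < e)%N -> eqm N f g -> eqm N (ps_subst e f) (ps_subst e g).
Proof.
move=> e_gt0 fg n n_lt; rewrite /ps_subst; case: ifP => // _.
by rewrite fg // (leq_ltn_trans (leq_div _ _)).
Qed.
End PowerSeries.

(** * The functions z and rho in characteristic 2 *)

Section Theta.
Variable k : fieldType.
Hypothesis char2 : 2%N \in [pchar k].
Implicit Types f g h : ps k.

Lemma k_addrr (a : k) : a + a = 0.
Proof. exact: addrr_pchar2. Qed.

Lemma ps_addrr f : f + f = 0.
Proof. by apply: psP => n; rewrite psD ps0E k_addrr. Qed.

Lemma ps_addKK f g : f + g + g = f.
Proof. by rewrite -addrA ps_addrr addr0. Qed.

Lemma eqm_addr0 N f g : eqm N g 0 -> eqm N (f + g) f.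
Proof. by move=> g0; have := eqmD (@eqm_refl _ N f) g0; rewrite addr0. Qed.

Definition boolean f := forall n, f n ^+ 2 = f n.

(** Frobenius: squaring is additive in characteristic 2 and fixes the coefficients, which are 0 or
    1. *)
Lemma boolean_sqr f : boolean f -> f * f = ps_subst 2 f.
Proof.
move=> fb; have ch : 2%N \in [pchar {poly k}] by rewrite (pchar_lalg {poly k}).
apply: psP => n; rewrite [LHS](@ps_mul_trunc _ n.+1) // -expr2.
rewrite -[_ ^+ 2](pFrobenius_autE ch) /ps_trunc poly_def raddf_sum /=.
rewrite (eq_bigr (fun i : 'I_n.+1 => f i *: 'X^(2 * i))); last first.
  move=> i _; rewrite pFrobenius_autE -mul_polyC exprMn -rmorphXn /= fb.
  by rewrite -exprM mulnC mul_polyC.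
rewrite coef_sum /ps_subst; case: (dvdnP (m := n)) => [[m ->]|ndv].
  have lt_m : (m < (m * 2).+1)%N by lia.
  rewrite mulnK // (bigD1 (Ordinal lt_m)) //= coefZ coefXn (mulnC 2 m) eqxx mulr1.
  rewrite big1 ?addr0 // => i; rewrite -val_eqE /= => /eqP ne_im.
  by rewrite coefZ coefXn; case: eqP => [|_]; [lia | rewrite mulr0].
rewrite big1 // => i _; rewrite coefZ coefXn; case: eqP => [E|_]; last by rewrite mulr0.
by case: ndv; exists (i : nat); lia.
Qed.

(* [zs d] and [es d] are the sums of [x^(d r)] over odd [r > 0] and over even
   [r > 0]; in particular [zs 0 = 0]. *)
Definition zs (d : nat) : ps k := fun n => ((d %| n)%N && odd (n %/ d))%:R.
Definition es (d : nat) : ps k := fun n => [&& (0 < n)%N, (d %| n)%N & ~~ odd (n %/ d)]%:R.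

(** Closed form [x^d / (1 + x^(2d))]: clearing such denominators turns the product formulas below
    into polynomial identities. *)
Lemma zsM d : (0 < d)%N -> zs d * (1 + psX k (2 * d)) = psX k d.
Proof.
move=> d0; apply: psP => n; rewrite mulrDr mulr1 mulrC psD psXM /zs /psX.
case: ltnP => [lt_n|le_n].
  rewrite addr0; congr (nat_of_bool _)%:R.
  apply/andP/eqP => [[/dvdnP[m E]]|->]; last by rewrite dvdnn divnn d0.
  rewrite {}E in lt_n *; rewrite mulnK // => om; have : (m < 2)%N by move: lt_n; rewrite ltn_mul2r d0.
  by case: m om {lt_n} => [|[|m]] //; rewrite mul1n.
have -> : (n == d) = false by apply/eqP; lia.
have -> : (d %| n - 2 * d)%N = (d %| n)%N by rewrite dvdn_subl // dvdn_mull.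
case: (dvdnP (m := n)) => [[m E]|] /=; last by rewrite addr0.
rewrite {}E in le_n *; rewrite -mulnBl !mulnK // oddB; last first.
  by rewrite -(leq_pmul2r d0).
by rewrite /= addbF k_addrr.
Qed.

Lemma esM d : (0 < d)%N -> es d * (1 + psX k (2 * d)) = psX k (2 * d).
Proof.
move=> d0; apply: psP => n; rewrite mulrDr mulr1 mulrC psD psXM /es /psX.
case: (ltnP n (2 * d)) => [lt_n|le_n].
  have -> : (n == 2 * d)%N = false by rewrite ltn_eqF.
  rewrite addr0; case: and3P => // -[n0 /dvdnP[m E]]; rewrite {}E in n0 lt_n *.
  rewrite mulnK // => om; have : (m < 2)%N by move: lt_n; rewrite ltn_mul2r d0.
  by case: m om {lt_n} n0 => [|[|m]].
have -> : (0 < n)%N by lia.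
have -> : (d %| n - 2 * d)%N = (d %| n)%N by rewrite dvdn_subl // dvdn_mull.
have -> : (0 < n - 2 * d)%N = (n != 2 * d)%N by lia.
case: (dvdnP (m := n)) => [[m E]|ndv] /=; last first.
  rewrite andbF addr0; case: eqP => // E; case: ndv; exists 2; lia.
rewrite {}E in le_n *; rewrite -mulnBl !mulnK // oddB; last first.
  by rewrite -(leq_pmul2r d0).
rewrite /= addbF; case: (m * d =P 2 * d)%N => [/eqP|] /=; last by rewrite k_addrr.
by rewrite eqn_pmul2r // => /eqP ->; rewrite addr0.
Qed.

Lemma one_psX_neq0 d : (0 < d)%N -> 1 + psX k d != 0.
Proof.
move=> d0; apply/eqP => /(congr1 (fun f : ps k => f 0%N)) /eqP.
by rewrite psD ps1E ps0E /psX /= (ltn_eqF d0) addr0 oner_eq0.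
Qed.

Lemma eqm0_psXM n f : eqm n (psX k n * f) 0.
Proof. by move=> i lt_i; rewrite psXM lt_i ps0E. Qed.

Lemma eqm0_leq m n f : (m <= n)%N -> eqm n f 0 -> eqm m f 0.
Proof. by move=> le f0 i lt_i; apply: f0; apply: leq_trans le. Qed.

Lemma zs_psX d : (0 < d)%N -> exists u, zs d = psX k d * u.
Proof.
move=> d0; exists (1 + psX k d * zs d); rewrite mulrDr mulr1 mulrA psXD.
apply: (mulIf (one_psX_neq0 (d := 2 * d) _)); first by lia.
rewrite addnn -mul2n mulrDl -mulrA zsM // mulrDr mulr1.
by rewrite (mulrC (psX k (2 * d))) ps_addKK.
Qed.

Lemma es_psX d : (0 < d)%N -> exists u, es d = psX k d * u.
Proof.
move=> d0; exists (psX k d * (1 + es d)); rewrite mulrA psXD.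
apply: (mulIf (one_psX_neq0 (d := 2 * d) _)); first by lia.
by rewrite addnn -mul2n esM // -mulrA mulrDl mul1r esM // ps_addKK mulr1.
Qed.

(* Expansions of z(v) = 1/(v + 1/v) and rho(v) = 1/(1 + v^-2) at v = x^a. *)
Definition zi (a : int) : ps k := zs `|a|%N.
Definition ri (a : int) : ps k := if (0 < a)%R then es `|a|%N else 1 + es `|a|%N.

Lemma zi_opp a : zi (- a) = zi a.
Proof. by rewrite /zi abszN. Qed.

(* The cases a > b > 0 and a > 0 > b of z(v) z(w) = z(v/w) (rho(v) + rho(w)). *)
Lemma zs_mul_lt m n : (0 < n)%N -> (n < m)%N ->
  zs m * zs n = zs (m - n) * (es m + es n).
Proof.
move=> n0 lt_nm.
have := one_psX_neq0 (d := 2 * m); have := one_psX_neq0 (d := 2 * n).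
have := one_psX_neq0 (d := 2 * (m - n)).
have := @zsM m; have := @zsM n; have := @zsM (m - n).
have := @esM m; have := @esM n; have Ed := psXD k (m - n) n.
rewrite subnK in Ed; last lia.
have -> : psX k (2 * m) = psX k m * psX k m by rewrite psXD mul2n addnn.
have -> : psX k (2 * n) = psX k n * psX k n by rewrite psXD mul2n addnn.
have -> : psX k (2 * (m - n)) = psX k (m - n) * psX k (m - n) by rewrite psXD mul2n addnn.
(* With [d = x^(m-n)] and [y = x^n] as free variables and three denominators cleared, a polynomial
   identity modulo 2 remains. *)
rewrite -Ed; move: (psX k (m - n)) (psX k n) (zs m) (zs n) (zs (m - n)) (es m) (es n).
move=> d y zm zn zd em en h1 h2 h3 h4 h5 n1 n2 n3.
have {}h1 := h1 n0; have {}h2 := h2 ltac:(lia); have {}h3 := h3 ltac:(lia).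
have {}h4 := h4 n0; have {}h5 := h5 ltac:(lia).
apply: (mulIf (n1 ltac:(lia))); apply: (mulIf (n2 ltac:(lia))); apply: (mulIf (n3 ltac:(lia))).
transitivity (d * y * y * (1 + d * d)).
  transitivity ((zm * (1 + d * y * (d * y))) * (zn * (1 + y * y)) * (1 + d * d)); first ring.
  by rewrite h5 h4.
have -> : zd * (em + en) * (1 + d * d) * (1 + y * y) * (1 + d * y * (d * y)) =
  (zd * (1 + d * d)) * (em * (1 + d * y * (d * y)) * (1 + y * y) +
    en * (1 + y * y) * (1 + d * y * (d * y))) by ring.
rewrite h1 h2 h3.
transitivity (d * y * y * (1 + d * d) + (d * (d * y * (d * y)) * (y * y) + d * (d * y * (d * y)) * (y * y))).
  by rewrite ps_addrr addr0.
ring.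
Qed.

Lemma zs_mul_add m n : (0 < n)%N -> (0 < m)%N ->
  zs m * zs n = zs (m + n) * (es m + (1 + es n)).
Proof.
move=> n0 m0.
have := one_psX_neq0 (d := 2 * m); have := one_psX_neq0 (d := 2 * n).
have := one_psX_neq0 (d := 2 * (m + n)).
have := @zsM m; have := @zsM n; have := @zsM (m + n).
have := @esM m; have := @esM n; have Ed := psXD k m n.
have -> : psX k (2 * m) = psX k m * psX k m by rewrite psXD mul2n addnn.
have -> : psX k (2 * n) = psX k n * psX k n by rewrite psXD mul2n addnn.
have -> : psX k (2 * (m + n)) = psX k (m + n) * psX k (m + n) by rewrite psXD mul2n addnn.
rewrite -Ed; move: (psX k m) (psX k n) (zs m) (zs n) (zs (m + n)) (es m) (es n).
move=> x y zm zn zd em en h1 h2 h3 h4 h5 n1 n2 n3.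
have {}h1 := h1 n0; have {}h2 := h2 m0; have {}h3 := h3 ltac:(lia).
have {}h4 := h4 n0; have {}h5 := h5 m0.
apply: (mulIf (n1 ltac:(lia))); apply: (mulIf (n2 ltac:(lia))); apply: (mulIf (n3 ltac:(lia))).
transitivity (x * y * (1 + x * y * (x * y))).
  transitivity ((zm * (1 + x * x)) * (zn * (1 + y * y)) * (1 + x * y * (x * y))); first ring.
  by rewrite h5 h4.
have -> : zd * (em + (1 + en)) * (1 + x * y * (x * y)) * (1 + y * y) * (1 + x * x) =
  (zd * (1 + x * y * (x * y))) * (em * (1 + x * x) * (1 + y * y) +
   (1 + x * x) * (1 + y * y) + en * (1 + y * y) * (1 + x * x)) by ring.
rewrite h1 h2 h3.
(* [t] is half the difference of the two sides computed over the integers; it is added twice because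
   [ring] does not know that 2 = 0. *)
pose t := x * y * (x * x + y * y + x * x * y * y).
transitivity (x * y * (1 + x * y * (x * y)) + (t + t)); first by rewrite ps_addrr addr0.
rewrite /t; ring.
Qed.

Lemma zi_mul (a b : int) : a != 0 -> b != 0 -> a != b ->
  zi a * zi b = zi (a - b) * (ri a + ri b).
Proof.
wlog lt_ba : a b / (b < a)%R.
  move=> H a0 b0 ab; case: (boolP (b < a)%R) => [lt|ge]; first exact: H.
  by rewrite mulrC H ?(addrC (ri b)); [rewrite -zi_opp opprB | lia..].
move=> a0 b0 _; rewrite /zi /ri.
case: (boolP (0 < b)%R) => [b_gt0|b_le0].
  have -> : (0 < a)%R by lia.
  rewrite zs_mul_lt; [|lia|lia]; congr (zs _ * _); lia.
case: (boolP (0 < a)%R) => [a_gt0|a_le0].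
  rewrite zs_mul_add; [|lia|lia]; congr (zs _ * _); lia.
(* Both indices are negative: each [ri] is [1 + es], and the two 1 cancel. *)
rewrite mulrC zs_mul_lt; [|lia|lia]; congr (zs _ * _); first lia.
transitivity (es `|b| + es `|a| + (1 + 1)); first by rewrite ps_addrr addr0.
by ring.
Qed.

Lemma eqm0_zi (a : int) N : (N <= `|a|)%N -> eqm N (zi a) 0.
Proof.
move=> le_N; have [a0|] := posnP `|a|%N; first by move=> n; lia.
by move=> /zs_psX[u Eu]; rewrite /zi Eu; apply: eqm0_leq le_N (@eqm0_psXM _ _).
Qed.

Lemma eqm0_ziM (a b : int) N : a != 0 -> b != 0 ->
  (N <= `|a| + `|b|)%N -> eqm N (zi a * zi b) 0.
Proof.
move=> a0 b0 le_N; rewrite /zi; have [|u ->] := @zs_psX `|a|; first lia.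
have [|v ->] := @zs_psX `|b|; first lia.
by rewrite mulrACA psXD; apply: eqm0_leq le_N (@eqm0_psXM _ _).
Qed.

Lemma eqm_ri_pos (a : int) N : (N%:Z <= a)%R -> eqm N (ri a) 0.
Proof.
rewrite /ri => le_N; case: ifP => [a0|]; last by move=> a_le n; lia.
have [|u ->] := @es_psX `|a|; first lia.
by apply: (eqm0_leq _ (@eqm0_psXM _ _)); lia.
Qed.

Lemma eqm_ri_neg (a : int) N : (a <= - N%:Z)%R -> eqm N (ri a) 1.
Proof.
rewrite /ri => le_N; case: ifP => [a0|a0]; first by move=> n; lia.
apply: eqm_addr0; have [a_eq|] := posnP `|a|%N; first by move=> n; lia.
move=> /es_psX[u ->]; by apply: (eqm0_leq _ (@eqm0_psXM _ _)); lia.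
Qed.

Lemma boolean_zs d : boolean (zs d).
Proof. by move=> n; rewrite /zs; case: (_ && _); rewrite ?expr1n ?expr0n. Qed.

Lemma zi_sqr a : zi a * zi a = ps_subst 2 (zi a).
Proof. exact/boolean_sqr/boolean_zs. Qed.

Lemma ps_subst_zs e d : (0 < e)%N -> (0 < d)%N -> ps_subst e (zs d) = zs (e * d).
Proof.
move=> e0 d0; apply: psP => n; rewrite /ps_subst /zs.
case: (dvdnP (m := n)) => [[m ->]|ndv]; last first.
  rewrite (_ : (e * d %| n)%N = false) //; apply/negP => /dvdnP[m E].
  by case: ndv; exists (m * d)%N; rewrite E; lia.
by rewrite mulnK // (mulnC m) dvdn_pmul2l // divnMA mulKn.
Qed.

Lemma ps_subst_zi (e : nat) (a : int) : (0 < e)%N -> a != 0 ->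
  ps_subst e (zi a) = zi (e%:Z * a).
Proof. by move=> e0 a0; rewrite /zi ps_subst_zs // ?abszM ?absz_gt0. Qed.
End Theta.

(** * Torsion points of the Tate curve *)

Section Lambert.
Variable k : fieldType.
Hypothesis char2 : 2%N \in [pchar k].
Implicit Types (f g h : ps k) (u : int -> ps k).

(* The sum of [u l] over the window [- s <= l < t]. *)
Definition wsum u (s t : nat) : ps k :=
  \sum_(m < t) u m%:Z + \sum_(m < s) u (- m.+1%:Z).

Lemma eqm_sum0 N (I : Type) (r : seq I) (P : pred I) (F : I -> ps k) :
  (forall i, P i -> eqm N (F i) 0) -> eqm N (\sum_(i <- r | P i) F i) 0.
Proof.
move=> F0 n n_lt; rewrite ps_sumE ps0E big1 // => i /F0 -> //; exact: ps0E.
Qed.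

Lemma wsum_ext N u s t s' t' :
  (forall l, (t%:Z <= l)%R -> eqm N (u l) 0) ->
  (forall l, (l < - s%:Z)%R -> eqm N (u l) 0) ->
  eqm N (wsum u (s + s') (t + t')) (wsum u s t).
Proof.
move=> ut us; rewrite /wsum !big_split_ord /=; apply: eqmD.
  by apply: eqm_addr0; apply: eqm_sum0 => i _; apply: ut; lia.
by apply: eqm_addr0; apply: eqm_sum0 => i _; apply: us; lia.
Qed.

Lemma wsum_shift u s t : wsum (fun l => u (l + 1)) s.+1 t = wsum u s t.+1.
Proof.
rewrite /wsum [in LHS]big_ord_recl [in RHS]big_ord_recl /= addrA; congr (_ + _).
  rewrite addrC; congr (u _ + _).
  by apply: eq_bigr => i _; congr (u _); rewrite /bump /=; lia.
by apply: eq_bigr => i _; congr (u _); rewrite /bump /=; lia.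
Qed.

Lemma wsum_tele u s t :
  wsum (fun l => u (l + 1) + u l) s t = u t%:Z + u (- s%:Z).
Proof.
have E n : \sum_(m < n) (u (m%:Z + 1) + u m%:Z) = u n%:Z + u 0.
  elim: n => [|n IH]; first by rewrite big_ord0; exact/esym/ps_addrr.
  rewrite big_ord_recr /= IH (_ : n.+1%:Z = n%:Z + 1); last lia.
  transitivity (u (n%:Z + 1) + u 0 + (u n%:Z + u n%:Z)); first by ring.
  by rewrite ps_addrr // addr0.
have E' n : \sum_(m < n) (u (- m.+1%:Z + 1) + u (- m.+1%:Z)) = u 0 + u (- n%:Z).
  elim: n => [|n IH]; first by rewrite big_ord0; exact/esym/ps_addrr.
  rewrite big_ord_recr /= IH (_ : - n.+1%:Z + 1 = - n%:Z) ?addrA; last lia.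
  by rewrite ps_addKK.
by rewrite /wsum E E' addrA ps_addKK.
Qed.

Lemma wsumD u v s t : wsum (fun l => u l + v l) s t = wsum u s t + wsum v s t.
Proof. by rewrite /wsum !big_split /=; ring. Qed.

Lemma wsumMl f u s t : f * wsum u s t = wsum (fun l => f * u l) s t.
Proof. by rewrite /wsum mulrDr !mulr_sumr. Qed.

Lemma ps_subst_wsum e u s t :
  ps_subst e (wsum u s t) = wsum (fun l => ps_subst e (u l)) s t.
Proof. by rewrite /wsum raddfD !raddf_sum. Qed.

Lemma eqm_wsum N u v s t : (forall l, eqm N (u l) (v l)) -> eqm N (wsum u s t) (wsum v s t).
Proof. by move=> uv; apply: eqmD; apply: eqm_sum => i _; apply: uv. Qed.

Lemma eq_wsum u v s t : u =1 v -> wsum u s t = wsum v s t.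
Proof. by move=> uv; rewrite /wsum; congr (_ + _); apply: eq_bigr => i _. Qed.

Variable p : nat.
Hypothesis p_gt0 : (0 < p)%N.

Definition W (j : int) := wsum (fun l => zi k (p%:Z * l + j)).
(* The sum over all integers [l]: its coefficient of [x^n] only involves the terms
   with [|p l + j| <= n]. *)
Definition Y (j : int) : ps k := fun n => W j (n.+1 + `|j|) (n.+1 + `|j|) n.

Lemma Y_W N j s t : (N + `|j| <= s)%N -> (N + `|j| <= t)%N -> eqm N (Y j) (W j s t).
Proof.
move=> le_s le_t n lt_nN; set K := (n.+1 + `|j|)%N.
have -> : s = (K + (s - K))%N by rewrite subnKC // /K; lia.
have -> : t = (K + (t - K))%N by rewrite subnKC // /K; lia.
have K_E : K%:Z = n%:Z + 1 + `|j| by rewrite /K; lia.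
apply/esym; apply: (@wsum_ext n.+1) => // l le_l; apply: eqm0_zi => //.
  suff : (n%:Z + 1 <= p%:Z * l + j) by lia.
  suff : (l <= p%:Z * l) by lia.
  nia.
suff : (p%:Z * l + j <= - (n%:Z + 1)) by lia.
suff : (p%:Z * l <= l) by lia.
nia.
Qed.

(** The window can be shorter than in [Y_W], since only the products with [g] have to vanish modulo
    [x^N] outside it. *)
Lemma Y_W_mul N g j s t :
  (forall l, (t%:Z <= l)%R -> eqm N (g * zi k (p%:Z * l + j)) 0) ->
  (forall l, (l < - s%:Z)%R -> eqm N (g * zi k (p%:Z * l + j)) 0) ->
  eqm N (g * Y j) (g * W j s t).
Proof.
move=> ht hs; pose K := (N + `|j|)%N.
apply: (@eqm_trans _ _ _ (g * W j (s + K) (t + K))).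
  by apply: eqmM => //; apply: Y_W; rewrite leq_addl.
by rewrite !wsumMl; apply: wsum_ext.
Qed.

Lemma Y_shift1 j : Y (j + p%:Z) = Y j.
Proof.
apply: eqmP => N; pose K := (N + `|j| + p)%N.
apply: (@eqm_trans _ _ _ (W (j + p%:Z) K.+1 K)); first by apply: Y_W; rewrite /K; lia.
rewrite (_ : W _ _ _ = W j K K.+1); last first.
  rewrite /W -wsum_shift; apply: eq_wsum => l; congr zi; ring.
by apply: eqm_sym; apply: Y_W; rewrite /K; lia.
Qed.

Lemma Y_shift j (l : int) : Y (p%:Z * l + j) = Y j.
Proof.
have Ypos i (m : nat) : Y (p%:Z * m%:Z + i) = Y i.
  elim: m => [|m IH]; first by rewrite mulr0 add0r.
  rewrite -IH -[RHS]Y_shift1; congr Y; lia.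
case: (boolP (0 <= l)%R) => l0.
  by rewrite (_ : l = `|l|%N%:Z); [exact: Ypos | lia].
rewrite -(Ypos _ `|l|%N); congr Y; nia.
Qed.

Lemma Y_opp j : Y (- j) = Y j.
Proof.
apply: eqmP => N; pose K := (N + `|j|)%N.
(* The window [- K <= l <= K] is stable under [l -> - l], which turns [p l + j] into the opposite of
   [p l - j]. *)
apply: (@eqm_trans _ _ _ (W (- j) K K.+1)); first by apply: Y_W; rewrite /K; lia.
rewrite (_ : W _ _ _ = W j K K.+1); first by apply: eqm_sym; apply: Y_W; rewrite /K; lia.
rewrite /W /wsum [in LHS]big_ord_recl [in RHS]big_ord_recl /= -!addrA; congr (_ + _).
  by rewrite -[LHS]zi_opp; congr zi; lia.
rewrite addrC; congr (_ + _); apply: eq_bigr => i _; rewrite -[LHS]zi_opp; congr zi;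
  rewrite /bump /=; lia.
Qed.

End Lambert.

(** * The duplication formula for the torsion points *)

Section Duplication.
Variable k : fieldType.
Hypothesis char2 : 2%N \in [pchar k].

(** The Lambert series of [x^m / (1 + x^(2m))] over odd [m], which [emb_F] identifies with [F];
    terms with [m > n] do not reach [x^n]. *)
Definition Fs : ps k := fun n => (\sum_(m < n.+1 | odd m) zs k m) n.

Lemma Fs_sum N K : (N <= K)%N -> eqm N Fs (\sum_(m < K | odd m) zs k m).
Proof.
move=> le_NK n lt_nN; rewrite /Fs -!(big_mkord (fun m => odd m)).
have -> : \sum_(0 <= m < K | odd m) zs k m = \sum_(0 <= m < n.+1 | odd m) zs k m +
  \sum_(n.+1 <= m < K | odd m) zs k m by rewrite -big_cat_nat //; lia.
rewrite psD [X in _ + X]ps_sumE [X in _ + X]big1_seq ?addr0 // => m /andP[om].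
rewrite mem_index_iota => /andP[lt_nm _].
by have := @eqm0_zi k char2 m%:Z n.+1 lt_nm n (ltnSn n); rewrite ps0E.
Qed.

Variable p : nat.
Hypothesis p_gt0 : (0 < p)%N.
Variable s : int.
Hypothesis ndvd_s : forall l : int, p%:Z * l + s != 0.

(* The sum over [l] telescopes by steps of [n], and [ri] tends to 1 at minus infinity
   and to 0 at plus infinity, whence [n] modulo 2. *)
Lemma ri_wsum N T n : (n <= N)%N -> (N + `|s| + 2 <= T)%N ->
  eqm N (wsum (fun l => ri k (p%:Z * (2 * l + n%:Z) + s) +
                        ri k (p%:Z * (2 * l - n%:Z) + s)) T T) (odd n)%:R.
Proof.
move=> le_nN le_T; have T_E : (N%:Z + `|s| + 2 <= T%:Z)%R by lia.
have pos (l : int) : (N%:Z + `|s| <= l)%R -> eqm N (ri k (p%:Z * l + s)) 0.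
  move=> le_l; apply: eqm_ri_pos => //; suff : (l <= p%:Z * l)%R by lia.
  nia.
have neg (l : int) : (l <= - (N%:Z + `|s|))%R -> eqm N (ri k (p%:Z * l + s)) 1.
  move=> le_l; apply: eqm_ri_neg => //; suff : (p%:Z * l <= l)%R by lia.
  nia.
elim/ltn_ind: n le_nN => -[|[|n]] IH le_nN.
- rewrite (@eq_wsum _ _ (fun=> 0)); first by rewrite /wsum !big1_eq addr0.
  by move=> l; rewrite (_ : 2 * l + 0%:Z = 2 * l - 0%:Z) ?ps_addrr //; ring.
- pose u (l : int) := ri k (p%:Z * (2 * l - 1) + s).
  rewrite (@eq_wsum _ _ (fun l => u (l + 1) + u l)); last first.
    by move=> l; rewrite /u; congr (ri k _ + ri k _); ring.
  rewrite wsum_tele // -[(odd 1)%:R]add0r.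
  by apply: eqmD; [apply: pos; lia | apply: neg; lia].
pose u (l : int) := ri k (p%:Z * (2 * l + n%:Z) + s).
pose v (l : int) := ri k (p%:Z * (2 * l - n%:Z - 2) + s).
rewrite (@eq_wsum _ _ (fun l => (u (l + 1) + u l) + (v (l + 1) + v l) +
    (ri k (p%:Z * (2 * l + n%:Z) + s) + ri k (p%:Z * (2 * l - n%:Z) + s)))); last first.
  move=> l; rewrite /u /v.
  have -> : 2 * (l + 1) + n%:Z = 2 * l + n.+2%:Z by lia.
  have -> : 2 * (l + 1) - n%:Z - 2 = 2 * l - n%:Z by lia.
  have -> : 2 * l - n%:Z - 2 = 2 * l - n.+2%:Z by lia.
  set a := ri k _; set b := ri k _; set c := ri k _; set d := ri k _.
  transitivity (a + b + ((c + c) + (d + d))); last by ring.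
  by rewrite !ps_addrr // !addr0.
rewrite wsumD (wsumD (fun l => u (l + 1) + u l)) !wsum_tele // oddS /= negbK -[(odd n)%:R]add0r.
apply: eqmD; last by apply: IH; lia.
(* Each telescoped sum is its value 0 at the upper end plus its value 1 at the lower end; the two
   contributions cancel. *)
have -> : (0 : ps k) = (0 + 1) + (0 + 1) by rewrite !add0r ps_addrr.
apply: eqmD; apply: eqmD; do [apply: pos | apply: neg]; lia.
Qed.

(** The term [l = 0] gives the square. The terms [l = m + 1] and [l = - (m + 1)] are expanded by
    [zi_mul] with the same factor [zs k (p * m.+1)], and the two copies of [ri k a] cancel. *)
Lemma Y_mul_zi N (a : int) : (forall l : int, p%:Z * l + a != 0) ->
  eqm N (Y k p a * zi k a) (zi k a * zi k a + \sum_(m < N) zs k (p * m.+1) *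
    (ri k (a + p%:Z * m.+1%:Z) + ri k (a - p%:Z * m.+1%:Z))).
Proof.
move=> a_nd; have a0 : a != 0 by have := a_nd 0; rewrite mulr0 add0r.
rewrite mulrC; apply: (@eqm_trans _ _ _ (zi k a * W k p a N N.+1)).
  apply: Y_W_mul => // l le_l; apply: eqm0_ziM => //.
    suff : (N%:Z <= p%:Z * l)%R by lia.
    nia.
  suff : (p%:Z * l <= - N%:Z)%R by lia.
  nia.
rewrite /W /wsum big_ord_recl mulr0 add0r -addrA -big_split /= mulrDr.
apply: eqmD => //; rewrite mulr_sumr; apply: eqm_sum => m _.
set b := p%:Z * _ + a; set c := p%:Z * _ + a.
have b0 : b != 0 by exact: a_nd.
have c0 : c != 0 by exact: a_nd.
have pm0 : (0 < p * m.+1)%N by rewrite muln_gt0 p_gt0.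
have Eb : b = a + (p * m.+1)%N%:Z by rewrite /b /bump /= PoszM; ring.
have Ec : c = a - (p * m.+1)%N%:Z by rewrite /c PoszM; ring.
rewrite -PoszM mulrDr !(mulrC (zi k a)) !zi_mul //; try lia.
rewrite (_ : zi k (b - a) = zs k (p * m.+1)); last by congr zs; lia.
rewrite (_ : zi k (c - a) = zs k (p * m.+1)); last by congr zs; lia.
rewrite -Eb -Ec -mulrDr; rewrite (_ : _ + _ + (_ + _) = ri k b + ri k c + (ri k a + ri k a)).
  by rewrite ps_addrr // addr0.
ring.
Qed.

Lemma wsum_sum (I : Type) (r : seq I) (u : I -> int -> ps k) t t' :
  wsum (fun l => \sum_(i <- r) u i l) t t' = \sum_(i <- r) wsum (u i) t t'.
Proof. by rewrite /wsum big_split /= ![\sum_(i <- r) _]exchange_big. Qed.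

(* The diagonal terms of the product give the square, and the terms at distance
   [p n] from the diagonal sum to [zs (p n)] times [n]. *)
Lemma Y_mul_double :
  Y k p s * Y k (2 * p) s = ps_subst 2 (Y k (2 * p) s) + ps_subst p Fs.
Proof.
apply: eqmP => N; pose T := (N + `|s| + 2)%N.
have YW : eqm N (Y k (2 * p) s) (W k (2 * p) s T T).
  by apply: Y_W => //; rewrite ?muln_gt0 // /T; lia.
apply: (eqm_trans (eqmM (@eqm_refl _ N (Y k p s)) YW)).
pose A (l : int) := (2 * p)%N%:Z * l + s.
have A0 l : A l != 0 by rewrite /A; have := ndvd_s (2 * l); rewrite PoszM -mulrA (mulrCA 2).
rewrite wsumMl; apply: eqm_trans.
  apply: eqm_wsum => l; rewrite -/(A l).
  (* [A l] is congruent to [s] modulo [p], so every term of the second factor meets the same series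
     [Y k p], recentred at [A l]. *)
  have -> : Y k p s = Y k p (A l).
    by rewrite -[LHS](@Y_shift _ char2 p p_gt0 s (2 * l)); congr Y; rewrite /A PoszM; ring.
  apply: Y_mul_zi => l'; have := ndvd_s (2 * l + l'); congr (_ != _).
  by rewrite /A PoszM; ring.
rewrite wsumD; apply: eqmD.
  apply: (@eqm_trans _ _ _ (ps_subst 2 (W k (2 * p) s T T))); last first.
    by apply: eqm_subst => //; exact: eqm_sym.
  by rewrite ps_subst_wsum; apply: eqm_wsum => l; rewrite zi_sqr.
rewrite wsum_sum; apply: (@eqm_trans _ _ _ (\sum_(m < N) zs k (p * m.+1) * (odd m.+1)%:R)).
  apply: eqm_sum => m _; rewrite -wsumMl; apply: eqmM => //.
  apply: eqm_trans (@ri_wsum N T m.+1 _ _) => //; apply: eqm_wsum => l n _.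
  by congr (_ n); congr (ri k _ + ri k _); rewrite /A PoszM; ring.
apply: eqm_sym; apply: eqm_trans (eqm_subst p_gt0 (@Fs_sum N N.+1 _)) _ => //.
move=> n _; congr (_ n); rewrite raddf_sum big_mkcond big_ord_recl /= add0r.
apply: eq_bigr => m _; rewrite /bump /= add1n ps_subst_zs //.
by case: (~~ odd m); rewrite ?mulr1 ?mulr0.
Qed.
End Duplication.

(** * Isogenies *)

Section Isogeny.
Variable k : fieldType.
Hypothesis char2 : 2%N \in [pchar k].

Lemma booleanD (f g : ps k) : boolean f -> boolean g -> boolean (f + g).
Proof.
move=> fb gb n; rewrite psD sqrrD fb gb -mulr_natr (pcharf0 char2) mulr0 addr0 //.
Qed.

Lemma boolean_sum (I : Type) (r : seq I) (P : pred I) (F : I -> ps k) :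
  (forall i, boolean (F i)) -> boolean (\sum_(i <- r | P i) F i).
Proof.
move=> Fb; elim/big_ind: _ => // [n|f g]; first by rewrite ps0E expr0n.
exact: booleanD.
Qed.

Lemma boolean_Y p j : boolean (Y k p j).
Proof.
by move=> n; apply: booleanD; apply: boolean_sum => i; apply: boolean_zs.
Qed.

Lemma sum_divn (F : nat -> ps k) p K :
  \sum_(d < p * K) F d = \sum_(m < K) \sum_(r < p) F (p * m + r)%N.
Proof.
elim: K => [|K IH]; first by rewrite muln0 !big_ord0.
by rewrite mulnSr big_split_ord /= IH big_ord_recr.
Qed.

Lemma zs0 : zs k 0 = 0.
Proof.
by apply: psP => n; rewrite ps0E /zs divn0 andbF.
Qed.

(* The generating series of the parity of the number of odd divisors. *)
Definition Es : ps k := fun n => (\sum_(d < n.+1) zs k d) n.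

Lemma Es_sum N K : (N <= K)%N -> eqm N Es (\sum_(d < K) zs k d).
Proof.
move=> le_NK n lt_nN; rewrite /Es -(subnKC (leq_trans lt_nN le_NK)).
rewrite [in RHS]big_split_ord /= psD [X in _ + X]ps_sumE [X in _ + X]big1 ?addr0 //.
move=> m _; have le_nm : (n.+1 <= n.+1 + m)%N by lia.
by have := @eqm0_zi k char2 (n.+1 + m)%N%:Z n.+1 le_nm n (ltnSn n); rewrite ps0E.
Qed.

Lemma ps_subst_zs0 e d : (0 < e)%N -> ps_subst e (zs k d) = zs k (e * d).
Proof.
by case: d => [|d] e0; [rewrite muln0 zs0 raddf0 | rewrite ps_subst_zs].
Qed.

(** The terms of even index in [Es] form [Es(x^2)]; those of odd index remain. *)
Lemma Es_frob : Es + ps_subst 2 Es = Fs k.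
Proof.
apply: eqmP => N; apply: (@eqm_trans _ _ _ (\sum_(m < N) zs k (2 * m + 1))); last first.
  apply: eqm_sym; apply: eqm_trans (@Fs_sum k char2 N (2 * N) _) _; first lia.
  rewrite big_mkcond (sum_divn (fun d => if odd d then zs k d else 0)).
  move=> n _; congr (_ n); apply: eq_bigr => m _.
  by rewrite !big_ord_recl big_ord0 /= addn0 oddD oddM /= add0r addr0.
apply: (@eqm_trans _ _ _ (\sum_(d < 2 * N) zs k d + ps_subst 2 (\sum_(d < N) zs k d))).
  by apply: eqmD; [apply: Es_sum; lia | apply: eqm_subst => //; apply: Es_sum].
rewrite sum_divn raddf_sum -big_split /= => n _; congr (_ n); apply: eq_bigr => m _.
by rewrite !big_ord_recl big_ord0 /= addn0 ps_subst_zs0 // addr0 addrAC ps_addrr // add0r.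
Qed.

Variable h : nat.
Let p := h.*2.+1.

Lemma sum_half (F : nat -> ps k) :
  \sum_(r < p) F r = F 0%N + \sum_(j < h) (F j.+1 + F (p - j.+1)%N).
Proof.
rewrite /p big_ord_recl /= -addnn big_split_ord /= big_split /=; congr (_ + (_ + _)).
rewrite [RHS](reindex_inj rev_ord_inj) /=; apply: eq_bigr => i _.
by congr F; rewrite /bump /=; have := ltn_ord i; lia.
Qed.

(** One representative of each pair of opposite nonzero residues modulo [p]. *)
Definition Ysum : ps k := \sum_(j < h) Y k p j.+1%:Z.

(** Up to sign, the integers [p l + j] with [0 < j <= h] are the positive integers not divisible by
    [p], each once; the multiples of [p] make up [Es(x^p)]. *)
Lemma Ysum_Es : Ysum = Es + ps_subst p Es.
Proof.
apply: eqmP => N; pose K := (N + p)%N.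
have YW (j : 'I_h) : eqm N (Y k p j.+1%:Z) (\sum_(m < K) (zs k (p * m + j.+1) + zs k (p * m + (p - j.+1)))).
  apply: eqm_trans (@Y_W k char2 p _ N j.+1%:Z K K _ _) _ => //.
  - by rewrite /K /p; have := ltn_ord j; lia.
  - by rewrite /K /p; have := ltn_ord j; lia.
  move=> n _; congr (_ n); rewrite /W /wsum -big_split /=; apply: eq_bigr => m _.
  by congr (zs k _ + zs k _); have := ltn_ord j; rewrite /p; lia.
rewrite /Ysum; apply: eqm_trans; first by apply: eqm_sum => j _; exact: YW.
apply: (@eqm_trans _ _ _ (\sum_(d < p * K) zs k d + ps_subst p (\sum_(d < K) zs k d))); last first.
  by apply: eqm_sym; apply: eqmD; [|apply: eqm_subst => //]; apply: Es_sum; rewrite /K /p; lia.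
rewrite sum_divn raddf_sum -big_split exchange_big /= => n _; congr (_ n).
apply: eq_bigr => m _; rewrite (sum_half (fun r => zs k (p * m + r))) addn0 ps_subst_zs0 //.
by rewrite addrAC ps_addrr // add0r.
Qed.

Lemma Ysum_sqr : Ysum + Ysum * Ysum = Fs k + ps_subst p (Fs k).
Proof.
rewrite boolean_sqr //; last by apply: boolean_sum => i; apply: boolean_Y.
rewrite Ysum_Es -Es_frob !raddfD /= !ps_substMn // mulnC; ring.
Qed.

(** This is [Y_mul_double] at [s = 2 j], where the series of level [2 p] is [Y_j(x^2) = Y_j^2]. *)
Lemma Y_duplication (j : int) : (forall l : int, p%:Z * l + j != 0) ->
  Y k p (2 * j) * Y k p j ^+ 2 = Y k p j ^+ 4 + ps_subst p (Fs k).
Proof.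
move=> nd_j.
have Y2 : Y k (2 * p) (2 * j) = ps_subst 2 (Y k p j).
  apply: eqmP => N; pose K := (N + `|(2 * j)%R|)%N.
  apply: (eqm_trans (@Y_W k char2 (2 * p) _ N (2 * j) K K _ _)) => //.
  apply: (@eqm_trans _ _ _ (ps_subst 2 (W k p j K K))); last first.
    by apply: eqm_subst => //; apply: eqm_sym; apply: Y_W => //; rewrite /K; lia.
  rewrite ps_subst_wsum; apply: eqm_wsum => l.
  rewrite ps_subst_zi // => n _; congr (zi k _ n); rewrite PoszM; ring.
(* Since [p] is odd, [2 j] is a multiple of [p] only if [j] is. *)
have nd2 (l : int) : p%:Z * l + 2 * j != 0.
  apply/eqP => E; have := nd_j (l %/ 2)%Z; have : (l %% 2)%Z = 0.
    by move: E; rewrite /p; lia.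
  move=> l2; have El : l = 2 * (l %/ 2)%Z by lia.
  by rewrite El in E; move=> /eqP; apply; lia.
have := @Y_mul_double k char2 p isT (2 * j) nd2; rewrite Y2 -!(boolean_sqr char2 (@boolean_Y p j)).
rewrite -(boolean_sqr char2 (f := Y k p j * Y k p j)).
  by rewrite -!expr2 -exprM.
move=> n; rewrite boolean_sqr //; last exact: boolean_Y.
by rewrite /ps_subst; case: ifP => _; [apply: boolean_Y | rewrite expr0n].
Qed.
End Isogeny.

Section CharTwo.
Variable R : comNzRingType.
Hypothesis char2 : 2%N \in [pchar R].
Implicit Types a b : R.

Lemma sqrD2 a b : (a + b) ^+ 2 = a ^+ 2 + b ^+ 2.
Proof. by rewrite sqrrD -mulr_natr (pcharf0 char2) mulr0 addr0. Qed.

Lemma exp4D2 a b : (a + b) ^+ 4 = a ^+ 4 + b ^+ 4.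
Proof. by rewrite !(exprM _ 2 2) !sqrD2. Qed.

Lemma exp16D2 a b : (a + b) ^+ 16 = a ^+ 16 + b ^+ 16.
Proof. by rewrite !(exprM _ 4 4) !exp4D2. Qed.

(** Makes [ring] usable modulo 2: [t] collects the terms that occur twice. *)
Lemma eq_char2 a b t : a = b + (t + t) -> a = b.
Proof. by move->; rewrite addrr_pchar2 // addr0. Qed.
End CharTwo.

(** * The level 5 modular equation *)

(** For [a = F + G] and [g = G], the hypothesis is the modular equation. The conclusion only
    involves powers [a^(2^i)], so it is additive in [a] up to the constant [g ^+ 4]. *)
Lemma level5_exp16 (R : comNzRingType) (a g : R) : 2%N \in [pchar R] ->
  a ^+ 6 = a * g + g ^+ 2 -> a ^+ 16 = g ^+ 4 * a ^+ 4 + g ^+ 3 * a + g ^+ 4.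
Proof.
move=> char2 a6; apply: (eq_char2 char2 (t := a ^+ 5 * g ^+ 3)).
transitivity ((a ^+ 6) ^+ 2 * a ^+ 4); first ring.
rewrite a6; transitivity (a ^+ 6 * g ^+ 2 + a ^+ 4 * g ^+ 4 + (a ^+ 5 * g ^+ 3 + a ^+ 5 * g ^+ 3)); first ring.
rewrite a6; ring.
Qed.

(** * The series [F], [G] and [D] over [k] *)

Section Embedding.
Variable k : fieldType.
Hypothesis char2 : 2%N \in [pchar k].

Lemma ps_pchar2 : 2%N \in [pchar ps k].
Proof. by apply/andP; split=> //; rewrite mulr2n ps_addrr. Qed.

Definition emb (f : series) : ps k := fun n => (f n)%:R.

Lemma natr_addb (a b : bool) : (a (+) b)%:R = a%:R + b%:R :> k.
Proof. by case: a; case: b; rewrite ?addr0 ?add0r ?k_addrr. Qed.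

Lemma natr_sumb (I : Type) (r : seq I) (P : pred I) (F : I -> bool) :
  (\big[addb/false]_(i <- r | P i) F i)%:R = \sum_(i <- r | P i) (F i)%:R :> k.
Proof. exact: (big_morph _ natr_addb). Qed.

Lemma embM f g : emb (smul f g) = emb f * emb g.
Proof.
apply: psP => n; rewrite /emb /smul natr_sumb psM; apply: eq_bigr => i _.
by case: (f i); rewrite ?mul1r ?mul0r.
Qed.

Lemma embX f n : emb (spow f n) = emb f ^+ n.
Proof.
elim: n => [|n IH]; first by apply: psP => i; rewrite expr0 ps1E.
by rewrite exprS -IH -embM.
Qed.

Lemma emb_boolean f : boolean (emb f).
Proof. by move=> n; rewrite /emb; case: (f n); rewrite ?expr1n ?expr0n. Qed.

Lemma emb_frobenius f a : emb (spow f (2 ^ a)) = ps_subst (2 ^ a) (emb f).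
Proof.
rewrite embX; elim: a => [|a IH].
  by rewrite expr1; apply: psP => n; rewrite /ps_subst dvd1n divn1.
rewrite expnS mulnC exprM IH expr2 boolean_sqr //; first by rewrite ps_substMn ?expn_gt0 // mulnC.
move=> n; rewrite /ps_subst; case: ifP => _; first exact: emb_boolean.
by rewrite expr0n.
Qed.

Lemma spow_frobenius f a n : spow f (2 ^ a) n = (2 ^ a %| n)%N && f (n %/ 2 ^ a)%N.
Proof.
have /(congr1 (fun h : ps k => h n)) := emb_frobenius f a; rewrite /emb /ps_subst.
case: ifP => _; case: (spow f _ n); rewrite ?eqxx //=; first by case: (f _) => // /eqP; rewrite oner_eq0.
- by case: (f _) => // /eqP; rewrite eq_sym oner_eq0.
- by move=> /eqP; rewrite oner_eq0.
Qed.

Lemma symm_sum n (c : nat -> nat -> k) : (forall i j, c i j = c j i) ->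
  \sum_(i < n) \sum_(j < n) c i j = \sum_(i < n) c i i.
Proof.
move=> c_sym; elim: n => [|n IH]; first by rewrite !big_ord0.
rewrite !big_ord_recr /= (eq_bigr (fun i : 'I_n => \sum_(j < n) c i j + c i n)); last first.
  by move=> i _; rewrite big_ord_recr.
rewrite big_split /= IH (eq_bigr (fun i : 'I_n => c n i)) => [|i _]; last exact: c_sym.
by rewrite -addrA (addrA _ _ (c n n)) k_addrr // add0r.
Qed.

Lemma FE n : F n = [exists m : 'I_n.+1, odd m && (m * m == n)%N].
Proof. by []. Qed.

Lemma sum_sqr_indic (P : pred nat) n :
  \sum_(i < n.+1) (P i && (i * i == n)%N)%:R =
  [exists m : 'I_n.+1, P m && (m * m == n)%N]%:R :> k.
Proof.
case: existsP => [[m /andP[Pm /eqP Em]]|nex].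
  rewrite (bigD1 m) //= Pm Em eqxx big1 ?addr0 // => i.
  rewrite -val_eqE /= => ne_im; case: eqP => [E|]; last by rewrite andbF.
  by case/eqP: ne_im; nia.
by apply: big1 => i _; case: (boolP (_ && _)) => // ok; case: nex; exists i.
Qed.

(** The coefficient of [x^n] in [Fs] counts the factorisations [n = i j] into odd factors modulo 2;
    exchanging [i] and [j] leaves only [i = j]. *)
Lemma emb_F : emb F = Fs k.
Proof.
apply: psP => n; rewrite /emb FE -(sum_sqr_indic odd) /Fs ps_sumE.
pose c i j : k := [&& odd i, odd j & (i * j == n)%N]%:R.
rewrite (eq_bigr (fun i : 'I_n.+1 => c i i)); last first.
  by move=> i _; rewrite /c andbA andbb.
rewrite -symm_sum => [|i j]; last by rewrite /c mulnC andbCA.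
rewrite [RHS]big_mkcond /=; apply: eq_bigr => i _; rewrite /c.
case: (boolP (odd i)) => oi; last by rewrite big1.
rewrite /zs; case: (dvdnP (m := n)) => [[m E]|ndv] /=; last first.
  by rewrite big1 // => j _; case: eqP => [E|]; rewrite ?andbF //; case: ndv; exists j; rewrite mulnC.
have i0 : (0 < i)%N by case: (nat_of_ord i) oi.
have lt_m : (m < n.+1)%N by rewrite E; nia.
rewrite (_ : n %/ i = m)%N; last by rewrite [X in (X %/ _)%N]E mulnK.
rewrite (bigD1 (Ordinal lt_m)) //= big1 ?addr0 => [|j].
  by rewrite mulnC -E eqxx andbT.
rewrite -val_eqE /= => ne; case: eqP => [E'|]; rewrite ?andbF //.
by case/eqP: ne; nia.
Qed.

Lemma emb_G : emb G = ps_subst 5 (emb F).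
Proof.
by apply: psP => n; rewrite /emb /G /ps_subst; case: ifP.
Qed.

Lemma emb_D : emb D = emb F + ps_subst 25 (emb F).
Proof.
apply: psP => n; rewrite psD /ps_subst {1}/emb.
have -> : D n = [exists m : 'I_n.+1, [pred i | (0 < i)%N && coprime i 10] m && (m * m == n)%N].
  by [].
rewrite /emb !FE; have iff1 (m : nat) : odd m = ((0 < m)%N && coprime m 10) || (odd m && (5 %| m)%N).
  rewrite -[10%N]/(2 * 5)%N coprimeMr coprimen2 [coprime m 5]coprime_sym (@prime_coprime 5) //.
  by case: m => // m; case: (odd _); case: (_ %| _)%N.
case: (boolP [exists m : 'I_n.+1, odd m && (m * m == n)%N]) => [/existsP[m /andP[om /eqP Em]]|nF].
  case: (boolP (5 %| m)%N) => [d5|nd5].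
    have [r Er] := dvdnP d5; have n25 : n = (r * r * 25)%N by nia.
    have -> : (25 %| n)%N by rewrite n25 dvdn_mull.
    have -> : [exists m : 'I_n.+1, [pred i | (0 < i)%N && coprime i 10] m && (m * m == n)%N] = false.
      apply/existsP => -[m' /andP[/andP[m'0 c10] /eqP Em']]; have : nat_of_ord m' = m by nia.
      move=> E; move: c10; rewrite E -[10%N]/(2 * 5)%N coprimeMr [coprime m 5]coprime_sym (@prime_coprime 5) //.
      by rewrite d5 andbF.
    have -> : [exists m0 : 'I_(n %/ 25).+1, odd m0 && (m0 * m0 == n %/ 25)%N].
      rewrite n25 mulnK //; have lt_r : (r < (r * r).+1)%N by nia.
      apply/existsP; exists (Ordinal lt_r); rewrite /= eqxx andbT.
      by move: om; rewrite Er oddM andbT.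
    by rewrite k_addrr.
  have -> : [exists m : 'I_n.+1, [pred i | (0 < i)%N && coprime i 10] m && (m * m == n)%N].
    apply/existsP; exists m; rewrite Em eqxx andbT /=.
    by have := iff1 m; rewrite om (negbTE nd5) andbF orbF => <-.
  rewrite (_ : (25 %| n)%N = false) ?addr0 //; apply/negP => d25.
  case/negP: nd5; have : (5 ^ 2 %| m ^ 2)%N by rewrite -[(m ^ 2)%N]mulnn Em.
  by rewrite dvdn_pexp2r.
have -> : [exists m : 'I_n.+1, [pred i | (0 < i)%N && coprime i 10] m && (m * m == n)%N] = false.
  apply/existsP => -[m /andP[c /eqP Em]]; case/negP: nF; apply/existsP; exists m.
  by rewrite Em eqxx andbT iff1 [X in X || _]c.
case: ifP => d25; last by rewrite addr0.
rewrite (_ : [exists m : 'I_(n %/ 25).+1, _] = false) ?addr0 //.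
apply/existsP => -[m /andP[om /eqP Em]]; case/negP: nF.
have En : n = (5 * m * (5 * m))%N by have /(congr1 (muln^~ 25%N)) := Em; rewrite /= (divnK d25) => E25; lia.
have lt_m : (5 * m < n.+1)%N by nia.
by apply/existsP; exists (Ordinal lt_m); rewrite /= -En eqxx oddM om.
Qed.

Lemma size_divG_coefs f n : size (divG_coefs f n) = n.
Proof. by elim: n => //= n IH; rewrite size_rcons IH. Qed.

Lemma nth_divG_coefs f n i : (i < n)%N -> nth false (divG_coefs f n) i = divG f i.
Proof.
rewrite /divG; elim: n => // n IH; rewrite ltnS leq_eqVlt => /orP[/eqP -> //|lt_in].
by rewrite /= nth_rcons size_divG_coefs lt_in IH.
Qed.

Lemma divGE f n : divG f n =
  f (n + 5)%N (+) \big[addb/false]_(i < n) (divG f i && G (n + 5 - i)%N).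
Proof.
rewrite {1}/divG /= nth_rcons size_divG_coefs ltnn eqxx; congr (_ (+) _).
by apply: eq_bigr => i _; rewrite nth_divG_coefs.
Qed.

Lemma emb_divG f : (forall n, (n < 5)%N -> f n = false) -> emb (divG f) * emb G = emb f.
Proof.
move=> f5; apply: psP => n; rewrite psM.
have G5 m : (m < 5)%N -> G m = false.
  by case: m => [|[|[|[|[|]]]]] // _; rewrite /G /= div0n FE; apply/existsP => -[] [[|m] ?].
have G5' : G 5 = true.
  by rewrite /G /= FE; apply/existsP; exists (Ordinal (isT : (1 < 2)%N)).
case: (ltnP n 5) => [lt_n5|le_5n].
  rewrite /emb f5 // big1 // => i _; rewrite G5 ?mulr0 //; lia.
rewrite -(subnK le_5n); set m := (n - 5)%N.
rewrite -addSn big_split_ord /= [X in _ + X]big1 ?addr0; last first.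
  by move=> i _; rewrite /emb G5 ?mulr0 //; lia.
rewrite big_ord_recr /= addKn /emb G5' mulr1 divGE natr_addb natr_sumb addrCA.
rewrite [X in _ + (_ + X)](eq_bigr (fun i : 'I_m => (divG f i)%:R * (G (m + 5 - i)%N)%:R)).
  by rewrite k_addrr // addr0.
by move=> i _; case: (divG f i); rewrite ?mul1r ?mul0r.
Qed.


Lemma F_1 : F 1 = true.
Proof. by rewrite FE; apply/existsP; exists (Ordinal (isT : (1 < 2)%N)). Qed.

(* With S = Y_1 + Y_2, the two duplication formulas give Y_1 Y_2 = S^3, and then
   G = S^5 (1 + S) and F = S (1 + S)^5. *)
Lemma modular_equation5 : (emb F + emb G) ^+ 6 = emb F * emb G.
Proof.
have ch := ps_pchar2.
pose y1 := Y k 5 1; pose y2 := Y k 5 2; pose S := y1 + y2.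
have S_eq : S + S * S = emb F + emb G.
  have := @Ysum_sqr k char2 2; rewrite emb_G emb_F /Ysum big_ord_recl big_ord1 /=; exact.
have nd (j : int) : (0 < j < 5)%R -> forall l : int, 5 * l + j != 0 by lia.
have e1 : y2 * y1 ^+ 2 = y1 ^+ 4 + emb G.
  by have := @Y_duplication k char2 2 1 (nd 1 isT); rewrite emb_G emb_F; exact.
have e2 : y1 * y2 ^+ 2 = y2 ^+ 4 + emb G.
  have := @Y_duplication k char2 2 2 (nd 2 isT); rewrite emb_G emb_F.
  (* 4 is congruent to -1 modulo 5, so doubling exchanges [y1] and [y2]. *)
  rewrite (_ : Y k 5 (2 * 2) = y1) //.
  rewrite -(Y_opp char2 (isT : (0 < 5)%N)) -(Y_shift char2 (isT : (0 < 5)%N) _ 1).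
  by congr Y.
have S0 : S != 0.
  apply/eqP => S0; move: S_eq; rewrite S0 mul0r addr0.
  move=> /(congr1 (fun f : ps k => f 1%N)) /eqP; rewrite ps0E psD /emb F_1 [G 1]/G /=.
  by rewrite addr0 eq_sym oner_eq0.
(* The sum of the two duplication formulas reads [y1 y2 S = y1^4 + y2^4 = S^4]. *)
have y12 : y1 * y2 = S ^+ 3.
  apply: (mulIf S0); rewrite -exprSr /S exp4D2 //.
  apply: (eq_char2 ch (t := emb G)).
  transitivity ((y2 * y1 ^+ 2) + y1 * y2 ^+ 2); first ring.
  by rewrite e1 e2; ring.
have Gs : emb G = S ^+ 5 + S ^+ 6.
  have Ey2 : y2 = S + y1 by rewrite /S addrAC ps_addrr // add0r.
  (* [y1] and [y2] are the roots of [X^2 + S X + S^3], which reduces every power of [y1]. *)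
  have q1 : y1 ^+ 2 = S * y1 + S ^+ 3.
    by rewrite -y12 Ey2; apply: (eq_char2 ch (t := - (y1 * S))); ring.
  have y14 : y1 ^+ 4 = S ^+ 3 * y1 + S ^+ 5 + S ^+ 6.
    transitivity ((y1 ^+ 2) ^+ 2); first by rewrite -exprM.
    by rewrite q1 sqrD2 // exprMn q1; ring.
  transitivity (y2 * y1 ^+ 2 + y1 ^+ 4); first by rewrite e1 addrAC ps_addrr // add0r.
  transitivity (y1 * S ^+ 3 + y1 ^+ 4); first by rewrite -y12; ring.
  by rewrite y14; apply: (eq_char2 ch (t := y1 * S ^+ 3)); ring.
have Fe : emb F = S + S * S + emb G by rewrite S_eq ps_addKK.
rewrite -S_eq Fe Gs; apply: (eq_char2 ch (t := S ^+ 6 * (1 + S) ^+ 2 * (S *+ 2 + S ^+ 2 *+ 3 + S ^+ 3 *+ 2))).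
ring.
Qed.

(** [D] is the sum of [F + G] and [G + F(x^25)]. Both satisfy [level5_exp16] with the same [g = G],
    the second by substituting [x^5] in the modular equation; adding them cancels [g ^+ 4]. *)
Lemma D_exp16 : emb D ^+ 16 = emb G ^+ 4 * emb D ^+ 4 + emb G ^+ 3 * emb D.
Proof.
have ch := ps_pchar2; have FG := modular_equation5.
pose H := ps_subst 25 (emb F).
have GH : (emb G + H) ^+ 6 = emb G * H.
  have [_ substM] := @ps_subst_monoid k 5 isT.
  have substX f n : ps_subst 5 (f ^+ n) = ps_subst 5 f ^+ n :> ps k.
    elim: n => [|n IH]; last by rewrite !exprS substM IH.
    by rewrite !expr0; case: (@ps_subst_monoid k 5 isT).
  have -> : H = ps_subst 5 (emb G) by rewrite emb_G ps_substMn.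
  by rewrite {1 3}emb_G -raddfD -substX FG substM.
have a6 : (emb F + emb G) ^+ 6 = (emb F + emb G) * emb G + emb G ^+ 2.
  by rewrite FG; apply: (eq_char2 ch (t := - emb G ^+ 2)); ring.
have b6 : (emb G + H) ^+ 6 = (emb G + H) * emb G + emb G ^+ 2.
  by rewrite GH; apply: (eq_char2 ch (t := - emb G ^+ 2)); ring.
have a16 := level5_exp16 ch a6; have b16 := level5_exp16 ch b6.
have -> : emb D = (emb F + emb G) + (emb G + H).
  by rewrite emb_D addrA ps_addKK.
move: a16 b16; move: (emb F + emb G) (emb G + H) => a b a16 b16.
rewrite exp16D2 // a16 b16 exp4D2 //.
by apply: (eq_char2 ch (t := emb G ^+ 4)); ring.
Qed.
End Embedding.

(** * Existence of places *)

Section ValuationRings.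
Variable K : fieldType.
Implicit Types (A O : set K) (x y z a : K).

Definition is_subring A :=
  [/\ A 1, forall x y, A x -> A y -> A (x - y) & forall x y, A x -> A y -> A (x * y)].

Definition is_valuation_ring O := is_subring O /\ forall x, O x \/ O x^-1.

Section Subring.
Variable A : set K.
Hypothesis subA : is_subring A.
Lemma subring1 : A 1. Proof. by case: subA. Qed.
Lemma subringB x y : A x -> A y -> A (x - y). Proof. by case: subA => _ + _; apply. Qed.
Lemma subringM x y : A x -> A y -> A (x * y). Proof. by case: subA => _ _; apply. Qed.
Lemma subring0 : A 0. Proof. by rewrite -(subrr 1); apply: subringB; apply: subring1. Qed.
Lemma subringD x y : A x -> A y -> A (x + y).
Proof.
by move=> Ax Ay; rewrite -[y]opprK -[- y]sub0r; apply/subringB/subringB => //; apply: subring0.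
Qed.
Lemma subring_sum (I : Type) (r : seq I) (P : pred I) (F : I -> K) :
  (forall i, P i -> A (F i)) -> A (\sum_(i <- r | P i) F i).
Proof. by move=> AF; elim/big_ind: _ => //; [apply: subring0 | apply: subringD]. Qed.
Lemma subringX x n : A x -> A (x ^+ n).
Proof.
by move=> Ax; elim: n => [|n IH]; rewrite ?exprS; [apply: subring1 | apply: subringM].
Qed.

Definition adjoin y : set K :=
  [set x | exists q : {poly K}, (forall i, A q`_i) /\ x = q.[y]].

Lemma adjoin_subring y : is_subring (adjoin y).
Proof.
split=> [|_ _ [q [Aq ->]] [r [Ar ->]]|_ _ [q [Aq ->]] [r [Ar ->]]].
- exists 1; split; last by rewrite hornerC.
  by move=> i; rewrite coef1; case: eqP => _; [apply: subring1 | apply: subring0].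
- exists (q - r); split; last by rewrite hornerD hornerN.
  by move=> i; rewrite coefB; apply: subringB.
- exists (q * r); split; last by rewrite hornerM.
  by move=> i; rewrite coefM; apply: subring_sum => j _; apply: subringM.
Qed.

Lemma sub_adjoin y : A `<=` adjoin y.
Proof.
move=> x Ax; exists x%:P; split; last by rewrite hornerC.
by move=> i; rewrite coefC; case: eqP => _ //; apply: subring0.
Qed.

Lemma adjoin_gen y : adjoin y y.
Proof.
exists 'X; split; last by rewrite hornerX.
by move=> i; rewrite coefX; case: eqP => _; [apply: subring1 | apply: subring0].
Qed.
End Subring.

Lemma maximal_subring A a : is_subring A -> A a -> ~ A a^-1 ->
  exists O, [/\ is_subring O, O a, ~ O a^-1 &
    forall B, is_subring B -> O `<=` B -> ~ B a^-1 -> B `<=` O].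
Proof.
(* Zorn's lemma also covers the empty chain, whose union is empty; hence [P] is stated for [A]
   joined with [X]. *)
move=> subA Aa nAa; pose P (X : set K) := is_subring (A `|` X) /\ ~ (A `|` X) a^-1.
have [F FP Ftot|X [[subX nXa] maxX]] := @Zorn_bigcup _ P.
  have lift2 x y : (A `|` \bigcup_(X in F) X) x -> (A `|` \bigcup_(X in F) X) y ->
      exists2 X, is_subring (A `|` X) /\ A `|` X `<=` A `|` \bigcup_(X in F) X & (A `|` X) x /\ (A `|` X) y.
    have sub X : F X -> A `|` X `<=` A `|` \bigcup_(X in F) X.
      by move=> FX t [At|Xt]; [left | right; exists X].
    have sub0 : is_subring (A `|` set0) by rewrite setU0.
    move=> [Ax|[X FX Xx]] [Ay|[Y FY Yy]].
    - by exists set0; [split=> // t [At|[]]; left | split; left].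
    - by exists Y; [split; [case: (FP _ FY) | apply: sub] | split; [left | right]].
    - by exists X; [split; [case: (FP _ FX) | apply: sub] | split; [right | left]].
    - case: (Ftot _ _ FX FY) => XY.
        by exists Y; [split; [case: (FP _ FY) | apply: sub] | split; right => //; apply: XY].
      by exists X; [split; [case: (FP _ FX) | apply: sub] | split; right => //; apply: XY].
  split; last by case=> [//|[X FX Xa]]; case: (FP _ FX) => _; apply; right.
  split=> [|x y Ux Uy|x y Ux Uy]; first by left; apply: subring1.
    have [X [sX sXU] [Xx Xy]] := lift2 _ _ Ux Uy.
    by apply: sXU; apply: subringB.
  have [X [sX sXU] [Xx Xy]] := lift2 _ _ Ux Uy.
  by apply: sXU; apply: subringM.
exists (A `|` X); split=> // [|B subB XB nBa]; first by left.
apply: contrapT => nBX; apply: (maxX B).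
  by split=> [t Xt|sBX]; [apply: XB; right | apply: nBX => t /sBX; right].
have /setUidPr E : A `<=` B by move=> t At; apply: XB; left.
by rewrite /P E.
Qed.

(* If neither y nor 1/y is in O, then 1/a is in O[y] and in O[1/y]; lower the total
   degree of such expressions of 1/a, using that 1 + aO consists of units. *)
Lemma chevalley A a : is_subring A -> A a -> ~ A a^-1 ->
  exists O, [/\ is_valuation_ring O, O a & ~ O a^-1].
Proof.
move=> subA Aa nAa; have [O [subO Oa nOa maxO]] := maximal_subring subA Aa nAa.
exists O; split=> //; split=> // y.
have a0 : a != 0 by apply: contra_notN nOa => /eqP ->; rewrite invr0; apply: subring0.
(* [B] is the localisation of [O] at the multiplicative set [1 + a O]; it does not contain [1/a], so
   it is contained in [O] by maximality. *)
have unit_O v : O v -> O (1 + a * v)^-1.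
  move=> Ov; pose B : set K := [set x | exists w u, [/\ O w, O u & x * (1 + a * w) = u]].
  have sOB : O `<=` B.
    by move=> x Ox; exists 0, x; rewrite mulr0 addr0 mulr1; split=> //; apply: subring0.
  have nz w : O w -> 1 + a * w != 0.
    move=> Ow; apply: contra_notN nOa => /eqP E.
    suff -> : a^-1 = 0 - w by apply: subringB => //; apply: subring0.
    apply: (mulfI a0); rewrite mulfV // sub0r mulrN; apply/eqP.
    by rewrite -addr_eq0 E.
  apply: (maxO B) => //.
  - split=> [|x1 x2 [w1 [u1 [Ow1 Ou1 E1]]] [w2 [u2 [Ow2 Ou2 E2]]]|x1 x2 [w1 [u1 [Ow1 Ou1 E1]]] [w2 [u2 [Ow2 Ou2 E2]]]].
    + by apply: sOB; apply: subring1.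
    + exists (w1 + w2 + a * (w1 * w2)), (u1 * (1 + a * w2) - u2 * (1 + a * w1)); split.
      * by do !(apply: subringD || apply: subringM).
      * by do !(apply: subringB || apply: subringD || apply: subringM || apply: subring1).
      * by rewrite -E1 -E2; ring.
    + exists (w1 + w2 + a * (w1 * w2)), (u1 * u2); split.
      * by do !(apply: subringD || apply: subringM).
      * exact: subringM.
      * by rewrite -E1 -E2; ring.
  - move=> [w [u [Ow Ou E]]]; apply: nOa.
    suff -> : a^-1 = u - w by apply: subringB.
    by apply: (mulfI a0); rewrite mulrBr -E; field.
  - by exists v, 1; split=> //; [apply: subring1 | rewrite mulVf // nz].
(* [Q z n]: [1/a] is a polynomial in [z] with [n] coefficients in [O]. *)
pose Q z n := exists c : nat -> K, (forall i, O (c i)) /\ a * (\sum_(i < n) c i * z ^+ i) = 1.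
have Q_of z : ~ O z -> exists n, Q z n.
  move=> nOz; have [q [Oq Eq]] : adjoin O z a^-1.
    apply: contrapT => nza; apply: nOz; apply: (maxO (adjoin O z)) => //.
    - exact: adjoin_subring.
    - exact: sub_adjoin.
    - exact: adjoin_gen.
  by exists (size q), (fun i => q`_i); split=> //; rewrite -horner_coef -Eq mulfV.
apply: contrapT => /not_orP[/Q_of[n Qn] nOy']; have [m Qm] := Q_of _ nOy'.
have y0 : y != 0.
  by apply: contra_notN nOy' => /eqP ->; rewrite invr0; apply: subring0.
suff key s : forall n m z, z != 0 -> (n + m <= s)%N -> Q z n -> Q z^-1 m -> False.
  exact: (key (n + m)%N n m y).
clear n m Qn Qm; elim: s => [|s IH] n m z z0 le_s Qzn Qzm.
  case: Qzn => c [_]; have -> : n = 0%N by lia.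
  by rewrite big_ord0 mulr0 => /eqP; rewrite eq_sym oner_eq0.
wlog le_mn : n m z z0 le_s Qzn Qzm / (m <= n)%N.
  move=> H; case: (leqP m n) => [|/ltnW] le; first exact: (H n m z).
  by apply: (H m n z^-1) => //; rewrite ?invr_eq0 ?invrK // addnC.
case: n => [|n] in le_s le_mn Qzn.
  by case: Qzn => c [_]; rewrite big_ord0 mulr0 => /eqP; rewrite eq_sym oner_eq0.
apply: (IH n m z) => //.
case: m => [|m] in le_s le_mn Qzm.
  by case: Qzm => c [_]; rewrite big_ord0 mulr0 => /eqP; rewrite eq_sym oner_eq0.
case: Qzn => c [Oc Ec]; case: Qzm => d [Od Ed].
pose u := (1 + a * - d 0%N)^-1.
have Ou : O u by apply: unit_O; rewrite -sub0r; apply: subringB => //; apply: subring0.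
(* Moving [d 0] to the other side and dividing by the unit [1 - a d 0] expresses [z ^+ n] by lower
   powers of [z]. As [m <= n], no negative power occurs; [d'] pads the coefficients with 0. *)
pose d' j := if (j <= m)%N then d j else 0.
have Od' j : O (d' j) by rewrite /d'; case: ifP => _ //; apply: subring0.
have Ezn : z ^+ n = a * u * \sum_(i < n) d' (n - i)%N * z ^+ i.
  have E1 : 1 + a * - d 0%N = a * \sum_(j < m) d j.+1 * z^-1 ^+ j.+1.
    by rewrite -[X in X + _]Ed big_ord_recl expr0 mulr1 /=; ring.
  have nz : 1 + a * - d 0%N != 0.
    apply: contra_notN nOa => /eqP E; suff -> : a^-1 = d 0%N by [].
    by apply: (mulfI a0); rewrite mulfV //; apply/eqP; rewrite -subr_eq0 -mulrN E.
  have -> : \sum_(i < n) d' (n - i)%N * z ^+ i = z ^+ n * \sum_(j < m) d j.+1 * z^-1 ^+ j.+1.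
    rewrite (reindex_inj rev_ord_inj) /= mulr_sumr.
    rewrite (big_ord_widen n (fun j => z ^+ n * (d j.+1 * z^-1 ^+ j.+1))) //.
    rewrite [RHS]big_mkcond; apply: eq_bigr => j _ /=; rewrite subKn // /d'.
    case: ifP => _; last by rewrite mul0r.
    rewrite mulrCA; congr (_ * _); rewrite exprVn; apply: (mulIf (x := z ^+ j.+1)).
      by rewrite expf_neq0.
    by rewrite divfK ?expf_neq0 // -exprD subnK.
  transitivity (z ^+ n * (u * (a * \sum_(j < m) d j.+1 * z^-1 ^+ j.+1))).
    by rewrite -E1 mulVf ?mulr1.
  by ring.
exists (fun i => c i + c n * (a * u) * d' (n - i)%N); split.
  by move=> i; do !(apply: subringD || apply: subringM).
rewrite -Ec big_ord_recr /= Ezn; congr (_ * _).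
rewrite [in RHS](mulrA (c n)) mulr_sumr -big_split /=; apply: eq_bigr => i _; ring.
Qed.
End ValuationRings.

(** * Comparing pole orders *)

Section ValuationOrder.
Variables (K : fieldType) (O : set K).
Hypothesis valO : is_valuation_ring O.
Implicit Types x y z g : K.

Let subO : is_subring O. Proof. by case: valO. Qed.

(* [vle x y]: the pole of [x] is of order at most that of [y]. *)
Definition vle x y := exists2 c, O c & x = c * y.
Definition vlt x y := ~ vle y x.
Definition veq x y := vle x y /\ vle y x.

Lemma vle_refl x : vle x x.
Proof. by exists 1; [apply: subring1 | rewrite mul1r]. Qed.
Lemma vle_trans y x z : vle x y -> vle y z -> vle x z.
Proof.
by move=> [c Oc ->] [d Od ->]; exists (c * d); [apply: subringM | rewrite mulrA].
Qed.
Lemma vle_total x y : vle x y \/ vle y x.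
Proof.
case: (eqVneq y 0) => [->|y0].
  by right; exists 0; [apply: subring0 | rewrite mul0r].
case: (eqVneq x 0) => [->|x0].
  by left; exists 0; [apply: subring0 | rewrite mul0r].
case: valO => _ /(_ (x / y)) [Oc|Oc]; [left | right].
  by exists (x / y) => //; rewrite divfK.
by exists (x / y)^-1 => //; rewrite invf_div divfK.
Qed.
Lemma vle0 x : vle 0 x.
Proof. by exists 0; [apply: subring0 | rewrite mul0r]. Qed.
Lemma vltW x y : vlt x y -> vle x y.
Proof. by case: (vle_total x y). Qed.
Lemma vle_lt_trans y x z : vle x y -> vlt y z -> vlt x z.
Proof. by move=> xy yz zx; apply: yz; apply: vle_trans xy. Qed.
Lemma vlt_le_trans y x z : vlt x y -> vle y z -> vlt x z.
Proof. by move=> xy yz zx; apply: xy; apply: vle_trans zx. Qed.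
Lemma vlt_neq0 x y : vlt x y -> y != 0.
Proof. by move=> xy; apply/eqP => y0; apply: xy; rewrite y0; apply: vle0. Qed.
Lemma vleM x y x' y' : vle x x' -> vle y y' -> vle (x * y) (x' * y').
Proof.
move=> [c Oc ->] [d Od ->]; exists (c * d); first exact: subringM.
by rewrite mulrACA.
Qed.
Lemma vleX n x y : vle x y -> vle (x ^+ n) (y ^+ n).
Proof.
by move=> [c Oc ->]; exists (c ^+ n); [apply: subringX | rewrite exprMn].
Qed.
Lemma vleD x y z : vle x z -> vle y z -> vle (x + y) z.
Proof.
by move=> [c Oc ->] [d Od ->]; exists (c + d); [apply: subringD | rewrite mulrDl].
Qed.
Lemma vltD x y z : vlt x z -> vlt y z -> vlt (x + y) z.
Proof.
case: (vle_total x y) => xy xz yz.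
  by apply: vle_lt_trans yz; apply: vleD => //; apply: vle_refl.
by apply: vle_lt_trans xz; apply: vleD => //; apply: vle_refl.
Qed.
Lemma vle_sum (I : Type) (r : seq I) (P : pred I) (F : I -> K) z :
  (forall i, P i -> vle (F i) z) -> vle (\sum_(i <- r | P i) F i) z.
Proof. by move=> Fz; elim/big_ind: _ => //; [apply: vle0 | move=> *; apply: vleD]. Qed.
Lemma vleMr_cancel x y z : z != 0 -> vle (x * z) (y * z) -> vle x y.
Proof. by move=> z0 [c Oc E]; exists c => //; apply: (mulIf z0); rewrite E mulrA. Qed.
Lemma vltMr x y z : z != 0 -> vlt x y -> vlt (x * z) (y * z).
Proof. by move=> z0 xy yx; apply: xy; apply: vleMr_cancel yx. Qed.
Lemma vltX n x y : (0 < n)%N -> vlt x y -> vlt (x ^+ n) (y ^+ n).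
Proof.
move=> n0 xy yx; apply: xy; case: (eqVneq x 0) => [x0|x0].
  case: yx => c _; rewrite x0 expr0n (gtn_eqF n0) mulr0 => /eqP.
  by rewrite expf_eq0 n0 => /eqP ->; apply: vle0.
case: yx => c Oc E; case: valO => _ /(_ (y / x)) [Oz|Oz].
  by exists (y / x) => //; rewrite divfK.
case: (eqVneq y 0) => [->|y0]; first exact: vle0.
exists (y / x); last by rewrite divfK.
have -> : y / x = c * (y / x)^-1 ^+ n.-1.
  apply: (mulIf (x := (y / x) ^+ n.-1)); first by rewrite expf_neq0 // mulf_neq0 // invr_eq0.
  rewrite exprVn divfK; last by rewrite expf_neq0 // mulf_neq0 // invr_eq0.
  by rewrite -exprS prednK // expr_div_n E mulfK // expf_neq0.
by apply: subringM => //; apply: subringX.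
Qed.
Lemma vleX_inv n x y : (0 < n)%N -> vle (x ^+ n) (y ^+ n) -> vle x y.
Proof. by move=> n0 xy; apply: contrapT => /(vltX n0); apply. Qed.
Lemma vltX_inv n x y : vlt (x ^+ n) (y ^+ n) -> vlt x y.
Proof. by move=> xy /(vleX n). Qed.

Lemma veq_refl x : veq x x. Proof. by split; apply: vle_refl. Qed.
Lemma veq_sym x y : veq x y -> veq y x. Proof. by case. Qed.
Lemma veq_trans y x z : veq x y -> veq y z -> veq x z.
Proof. by move=> [xy yx] [yz zy]; split; [apply: vle_trans yz | apply: vle_trans yx]. Qed.
Lemma veqM x y x' y' : veq x x' -> veq y y' -> veq (x * y) (x' * y').
Proof. by move=> [? ?] [? ?]; split; apply: vleM. Qed.
Lemma veqX n x y : veq x y -> veq (x ^+ n) (y ^+ n).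
Proof. by move=> [? ?]; split; apply: vleX. Qed.
Lemma veqX_inv n x y : (0 < n)%N -> veq (x ^+ n) (y ^+ n) -> veq x y.
Proof. by move=> n0 [? ?]; split; apply: (vleX_inv n0). Qed.
Lemma veqMr_cancel x y z : z != 0 -> veq (x * z) (y * z) -> veq x y.
Proof. by move=> z0 [? ?]; split; apply: (vleMr_cancel z0). Qed.
Lemma veqDr x e : vlt e x -> veq (x + e) x.
Proof.
move=> ex; split; first by apply: vleD; [apply: vle_refl | apply: vltW].
apply: contrapT => lt; have : vlt (x + e - e) x.
  apply: vltD => //; apply: vle_lt_trans ex.
  by exists (-1); [rewrite -sub0r; apply: subringB => //; [apply: subring0 | apply: subring1] | rewrite mulN1r].
by rewrite addrK; apply; apply: vle_refl.
Qed.

Lemma vmax (T : eqType) (s : seq T) (F : T -> K) : s != [::] ->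
  exists2 i, i \in s & forall j, j \in s -> vle (F j) (F i).
Proof.
elim: s => // a [|b s] IH _.
  by exists a; rewrite ?mem_head // => j; rewrite inE => /eqP ->; apply: vle_refl.
have [//|i i_s i_max] := IH; case: (vle_total (F a) (F i)) => le_ai.
  exists i; first by rewrite inE i_s orbT.
  by move=> j; rewrite inE => /orP[/eqP ->|/i_max].
exists a; first exact: mem_head.
move=> j; rewrite inE => /orP[/eqP ->|/i_max le_ji]; first exact: vle_refl.
exact: vle_trans le_ai.
Qed.

Lemma vlt1_exp g m n : vlt 1 g -> (m < n)%N -> vlt (g ^+ m) (g ^+ n).
Proof.
move=> g1 lt_mn; have g0 := vlt_neq0 g1.
rewrite -(subnK (ltnW lt_mn)) exprD -[X in vlt X _]mul1r.
by apply: vltMr; [rewrite expf_neq0 | rewrite -(expr1n _ (n - m)); apply: vltX; rewrite ?subn_gt0].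
Qed.
Lemma vle1_exp g m n : vlt 1 g -> (m <= n)%N -> vle (g ^+ m) (g ^+ n).
Proof.
rewrite leq_eqVlt => g1 /orP[/eqP ->|]; first exact: vle_refl.
by move=> /(vlt1_exp g1) /vltW.
Qed.
Lemma vle_exp_inv g m n : vlt 1 g -> vle (g ^+ m) (g ^+ n) -> (m <= n)%N.
Proof.
by move=> g1 le; case: leqP => // /(vlt1_exp g1).
Qed.

(* At an index maximising [Y], the term [Y i ^+ 4] strictly dominates the other
   two as soon as it exceeds [M]. *)
Lemma duplication_bound (T : eqType) (s : seq T) (sigma : T -> T) (Y : T -> K) t M :
  (forall i, i \in s -> sigma i \in s) ->
  (forall i, i \in s -> Y (sigma i) * Y i ^+ 2 = Y i ^+ 4 + t) ->
  vle 1 M -> vle t M -> forall i, i \in s -> vle (Y i ^+ 4) M.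
Proof.
move=> s_sigma Ydup M1 tM i i_s.
have [|m m_s m_max] := @vmax _ s Y; first by case: (s) i_s.
suff Hm : vle (Y m ^+ 4) M by apply: vle_trans Hm; apply: vleX; apply: m_max.
apply: contrapT => ltM.
have Ym1 : vlt 1 (Y m).
  by move=> le1; apply: ltM; apply: vle_trans M1; rewrite -[X in vle _ X](expr1n _ 4); apply: vleX.
have lt1 : vlt (Y (sigma m) * Y m ^+ 2) (Y m ^+ 4).
  apply: (vle_lt_trans (y := Y m ^+ 3)); last exact: vlt1_exp.
  by rewrite exprS; apply: vleM; [apply: m_max; apply: s_sigma | apply: vle_refl].
have lt2 : vlt (- t) (Y m ^+ 4).
  apply: (vle_lt_trans (y := t)); last by apply: vle_lt_trans ltM.
  by exists (-1); [rewrite -sub0r; apply: subringB => //; [apply: subring0 | apply: subring1] | rewrite mulN1r].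
have := vltD lt1 lt2; rewrite (Ydup m m_s) addrK; apply; exact: vle_refl.
Qed.

Hypothesis char2 : 2%N \in [pchar K].

(** [M] plays the role of the larger of 1 and [F1]. At a pole of [F1], [S] and [S ^+ 2] have order
    at most a quarter and a half of that of [F1], so they do not affect it. *)
Lemma isogeny_veq F0 F1 S : F0 + F1 = S + S ^+ 2 ->
  (forall M, vle 1 M -> vle F1 M -> vle (S ^+ 4) M) ->
  (vlt 1 F1 -> veq F0 F1) /\ (vle F1 1 -> vle F0 1).
Proof.
move=> E bound.
have E0 : F0 = F1 + (S + S ^+ 2).
  by rewrite -E addrCA addrr_pchar2 // addr0.
split=> F11.
  have S4 := bound _ (vltW F11) (vle_refl F1).
  rewrite E0; apply: veqDr; apply: vltD.
    apply: (@vltX_inv 4); apply: vle_lt_trans S4 _.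
    by rewrite -[X in vlt X _]expr1; apply: vlt1_exp.
  apply: (@vltX_inv 2); rewrite -exprM; apply: vle_lt_trans S4 _.
  by rewrite -[X in vlt X _]expr1; apply: vlt1_exp.
have S4 := bound _ (vle_refl 1) F11.
have S1 : vle S 1 by apply: (@vleX_inv 4) => //; rewrite expr1n.
rewrite E0; apply: vleD => //; apply: vleD => //.
by rewrite -(expr1n _ 2); apply: vleX.
Qed.

(** If [d ^+ 3] had a larger pole than [g], then [d ^+ 16] would strictly dominate both terms on the
    right, since [16 = 3 * 4 + 4] and [16 > 3 * 3 + 1]. *)
Lemma D_bound d G g : d ^+ 16 = G ^+ 4 * d ^+ 4 + G ^+ 3 * d ->
  vlt 1 g -> vle G g -> vle (d ^+ 3) g.
Proof.
move=> Ed g1 Gg; apply: contrapT => gd.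
have d3 : vlt 1 (d ^+ 3) by apply: vle_lt_trans (vltW g1) gd.
have d1 : vlt 1 d by apply: (@vltX_inv 3); rewrite expr1n.
have d0 := vlt_neq0 d1.
have Gd : vlt G (d ^+ 3) by apply: vle_lt_trans gd.
have lt1 : vlt (G ^+ 4 * d ^+ 4) (d ^+ 16).
  rewrite -[16%N]/(12 + 4)%N exprD; apply: vltMr; first by rewrite expf_neq0.
  by rewrite -[12%N]/(3 * 4)%N exprM; apply: vltX.
have lt2 : vlt (G ^+ 3 * d) (d ^+ 16).
  apply: (vlt_le_trans (y := d ^+ 9 * d)).
    by apply: vltMr => //; rewrite -[9%N]/(3 * 3)%N exprM; apply: vltX.
  by rewrite -exprSr; apply: vle1_exp.
by have := vltD lt1 lt2; rewrite -Ed; apply; apply: vle_refl.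
Qed.

(** Modulo 2 the equation divided by [d] is [(d^3 + g)^4 d^3 = g^3]. If [d^3] had a smaller pole
    than [g], the left side would have the order of [g^4 d^3], which is too large. *)
Lemma D_large d g : d ^+ 16 = g ^+ 4 * d ^+ 4 + g ^+ 3 * d -> vlt 1 d ->
  [/\ vlt 1 g, veq (d ^+ 3) g & veq ((d ^+ 3 + g) ^+ 2) g].
Proof.
move=> Ed d1; have d0 := vlt_neq0 d1.
have g1 : vlt 1 g.
  move=> g1; have dle n : vle (d ^+ 3 * d) (d ^+ 16) -> vle (g ^+ n * d) (d ^+ 4).
    move=> _; apply: (vle_trans (y := 1 * d)).
      by apply: vleM; [rewrite -(expr1n _ n); apply: vleX | apply: vle_refl].
    by rewrite mul1r -[X in vle X _]expr1; apply: vle1_exp.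
  have : vle (d ^+ 16) (d ^+ 4).
    rewrite {1}Ed; apply: vleD.
      rewrite -[X in vle _ X]mul1r; apply: vleM; last exact: vle_refl.
      by rewrite -(expr1n _ 4); apply: vleX.
    by apply: dle; rewrite -exprSr; apply: vle1_exp.
  by apply/vlt1_exp.
have d3g : vle (d ^+ 3) g by apply: D_bound Ed g1 (vle_refl g).
have key : (d ^+ 3 + g) ^+ 4 * d ^+ 3 = g ^+ 3.
  apply: (mulIf d0).
  have -> : (d ^+ 3 + g) ^+ 4 * d ^+ 3 * d = d ^+ 16 + g ^+ 4 * d ^+ 4 +
     ((d ^+ 13 * g) *+ 2 + (d ^+ 10 * g ^+ 2) *+ 3 + (d ^+ 7 * g ^+ 3) *+ 2) *+ 2 by ring.
  by rewrite -[_ *+ 2 in LHS]mulr_natr (pcharf0 char2) mulr0 addr0 Ed addrAC addrr_pchar2 // add0r.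
have gd3 : vle g (d ^+ 3).
  apply: contrapT => lt; have e1 : veq (d ^+ 3 + g) g by rewrite addrC; apply: veqDr.
  have [_ E] := veqM (veqX 4 e1) (veq_refl (d ^+ 3)).
  have g0 := vlt_neq0 g1; have : vle (d ^+ 3) 1.
    apply: (vleMr_cancel (z := g ^+ 3)); first by rewrite expf_neq0.
    rewrite mul1r -[X in vle _ X]key; apply: vle_trans E; rewrite mulrC.
    by apply: vleM; [apply: vle1_exp | apply: vle_refl].
  by rewrite -(expr1n _ 3); apply: vltX.
split=> //.
have : veq ((d ^+ 3 + g) ^+ 4 * g) (g ^+ 2 * g).
  rewrite -exprSr -key; apply: veqM; [exact: veq_refl | by split].
move=> /(veqMr_cancel (vlt_neq0 g1)).
by rewrite (exprM _ 2 2) => /veqX_inv; apply.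
Qed.

End ValuationOrder.

(** * Isogenies and places *)

(** By Fermat, [p] divides [2^(p-1) - 1], the order of the unit group of the field with [2^(p-1)]
    elements; Cauchy's theorem then gives an element of order [p]. *)
Lemma exists_root_of_unity p : prime p -> odd p ->
  exists (k : fieldType) (z : k), [/\ 2%N \in [pchar k], z ^+ p = 1 & z != 1].
Proof.
move=> p_pr p_odd; have p_gt1 := prime_gt1 p_pr.
have [|Fm ch card_Fm] := @pPrimePowerField 2 p.-1 isT; first by rewrite -ltnS prednK // ltnW.
have dvd_p : (p %| #|[set: {unit Fm}]%SET|)%N.
  rewrite card_finField_unit card_Fm -subn1 -eqn_mod_dvd ?expn_gt0 //.
  have := @Euler_exp_totient 2 p; rewrite totient_prime // => /(_ _)/eqP; apply.
  by rewrite coprime2n.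
have [x _ ox] := Cauchy p_pr dvd_p.
exists Fm, (val x); split=> //.
  by rewrite -FinRing.val_unitX -ox expg_order.
apply/eqP => x1; have : x = 1%g by apply: val_inj.
by move/eqP; rewrite -order_eq1 ox; lia.
Qed.

Definition ps_substR (k : fieldType) (e : nat) (e_gt0 : (0 < e)%N) : {rmorphism ps k -> ps k} :=
  HB.pack (@ps_subst k e)
    (GRing.isZmodMorphism.Build (ps k) (ps k) (@ps_subst k e) (@ps_subst_zmod k e))
    (GRing.isMonoidMorphism.Build (ps k) (ps k) (@ps_subst k e) (@ps_subst_monoid k e e_gt0)).

(** The formula for [D_n] with arbitrary field elements [d] and [g] in place of [D] and [G]. *)
Definition dk (K : fieldType) (d g : K) (n : nat) : K :=
  g ^+ (2 * (n %/ 10)) *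
  (if (n %% 10 == 1)%N then d else if (n %% 10 == 3)%N then d ^+ 8 / g
   else if (n %% 10 == 7)%N then d ^+ 2 * g else if (n %% 10 == 9)%N then d ^+ 4 * g else 0).

Section IsogenyPlaces.
Variables (k : fieldType) (K : fieldType).
Hypothesis char2 : 2%N \in [pchar k].
Variables (O : set K) (phi : {rmorphism ps k -> K}).
Hypothesis valO : is_valuation_ring O.

Lemma K_char2 : 2%N \in [pchar K].
Proof. exact: (rmorph_pchar phi (ps_pchar2 char2)). Qed.

(** As [p] is odd, doubling preserves the nonzero residues modulo [p], so the duplication formula
    bounds every [Y_j] and hence their sum. The second clause is for deducing a pole of [F1] from
    one of [F0]. *)
Lemma isogeny_places p : odd p ->
  let F0 := phi (emb k F) in let F1 := phi (ps_subst p (emb k F)) in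
  (vlt O 1 F1 -> veq O F0 F1) /\ (vle O F1 1 -> vle O F0 1).
Proof.
move=> p_odd /=; pose h := p./2.
have p_E : p = h.*2.+1 by rewrite -[LHS]odd_double_half p_odd.
have p0 : (0 < p)%N by rewrite p_E.
apply: (isogeny_veq valO K_char2 (S := phi (Ysum k h))).
  rewrite -rmorphXn -!rmorphD /= expr2 Ysum_sqr // emb_F //.
  by rewrite -p_E.
move=> M M1 FM; pose s := iota 1 p.-1.
have s_P i : (i \in s) = (0 < i < p)%N by rewrite mem_iota; lia.
pose y (i : nat) := phi (Y k p i%:Z).
have y_bound i : i \in s -> vle O (y i ^+ 4) M.
  apply: (duplication_bound valO (sigma := fun i => (2 * i %% p)%N) _ _ M1 FM) => j.
    rewrite !s_P => /andP[j0 lt_jp]; rewrite ltn_mod p0 andbT lt0n.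
    apply/negP => /eqP/eqP; rewrite -/(p %| _)%N Gauss_dvdr ?coprimen2 //.
    by move=> /dvdn_leq; lia.
  rewrite s_P => /andP[j0 lt_jp].
  have nd (l : int) : h.*2.+1%:Z * l + j%:Z != 0.
    apply/eqP => E; have : (p %| j)%N.
      have : (p%:Z %| j%:Z)%Z by apply/dvdzP; exists (- l); rewrite p_E; lia.
      by [].
    by move=> /dvdn_leq; lia.
  have E := Y_duplication char2 nd; rewrite -p_E -emb_F // in E.
  have {}E := congr1 phi E.
  rewrite [LHS](rmorphM phi) [RHS](rmorphD phi) !(rmorphXn phi) /= in E.
  rewrite /y -E; congr (phi _ * _).
  rewrite -[LHS](@Y_shift _ char2 p p0 _ (2 * j %/ p)%N%:Z); congr (Y k p _).
  have := divn_eq (2 * j) p; lia.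
(* For [p = 1] the sum is empty and the list [s] has no largest term. *)
case: (posnP h) => [h0|h_gt0].
  rewrite /Ysum h0 big_ord0 rmorph0 expr0n; exact: vle0.
have [|m m_s m_max] := @vmax _ _ valO _ s y; first by rewrite /s p_E; case: (h) h_gt0.
apply: (vle_trans valO _ (y_bound m m_s)); apply: vleX => //.
rewrite /Ysum rmorph_sum; apply: vle_sum => // i _; rewrite -p_E; apply: (m_max i.+1).
by rewrite s_P; have := ltn_ord i; lia.
Qed.

Lemma phi_Dk n : phi (emb k G) != 0 ->
  phi (emb k (Dk n)) = dk (phi (emb k D)) (phi (emb k G)) n.
Proof.
move=> G0; rewrite /Dk embM // rmorphM embX // rmorphXn /dk; congr (_ * _).
rewrite /Dbase; case: ifP => // _; case: ifP => [_|_].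
  apply: (mulIf G0); rewrite divfK // -rmorphM emb_divG //.
    by rewrite embX // rmorphXn.
  (* [D^8 = D(x^8)] only has exponents divisible by 8, and no constant term, so division by [G] is
     exact. *)
  move=> i i5; rewrite (spow_frobenius char2 D 3); apply/negP => /andP[/dvdnP[m Em] Di].
  have i0 : i = 0%N by lia.
  by move: Di; rewrite i0 div0n /D => /existsP[] [[|m'] ?].
case: ifP => _; first by rewrite embM // embX // rmorphM rmorphXn.
case: ifP => _; first by rewrite embM // embX // rmorphM rmorphXn.
have -> : emb k szero = 0 by apply: psP => i; rewrite ps0E.
exact: rmorph0.
Qed.

Lemma phi_D16 : phi (emb k D) ^+ 16 =
  phi (emb k G) ^+ 4 * phi (emb k D) ^+ 4 + phi (emb k G) ^+ 3 * phi (emb k D).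
Proof. by rewrite -!rmorphXn -!rmorphM -rmorphD /= D_exp16. Qed.
End IsogenyPlaces.

(** * Leading exponents of sums of basis elements *)

Definition is_unit10 (n : nat) :=
  [\/ n %% 10 = 1, n %% 10 = 3, n %% 10 = 7 | n %% 10 = 9]%N.

(* When [g] has a pole of order 6 and [d ^+ 3] one too, [dk d g n] has order [vt n];
   at any place where [G] and [g] have the same pole of order 3, [dk d G n] has order
   at most [wt n]. *)
Definition wt (n : nat) : nat :=
  6 * (n %/ 10) + (if n %% 10 == 1 then 1 else if n %% 10 == 9 then 7 else 5)%N.

Definition vt (n : nat) : nat :=
  12 * (n %/ 10) + (if n %% 10 == 1 then 2 else if n %% 10 == 9 then 14 else 10)%N.

Definition class19 (n : nat) := (n %% 10 == 1)%N || (n %% 10 == 9)%N.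

(* The other exponent carrying the same leading valuation as [n], when the two
   basis elements can cancel: see [dk_pair19] and [dk_pair37]. *)
Definition partner (n : nat) : nat := (if n %% 10 == 1 then n - 2 else n - 4)%N.

(** Leading terms of partners cancel, leaving one factor [d^3 + g] (residue 1) or its square
    (residue 7), each of order 3 instead of 6. *)
Definition vt_pair (n : nat) : nat := (if n %% 10 == 1 then vt n - 3 else vt n - 6)%N.

(** A lower bound for the order of a sum with largest index [n], cancellation included. For
    [n = 10 q + 1] cancellation leaves [12 q - 1], one less; hence the correction by [m %% 10 == 1]
    where it is used. *)
Definition vt_min (n : nat) : nat :=
  12 * (n %/ 10) + (if n %% 10 == 1 then 0 else if n %% 10 == 9 then 14 else 4)%N.

Lemma vt_ltn m n : is_unit10 m -> is_unit10 n -> class19 n = class19 m -> (n <= m)%N ->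
  n != m -> (vt n < vt m)%N \/ n = partner m.
Proof.
rewrite /class19 /vt /partner => -[] E [] E'; rewrite E' ?E ?eqE //= => _; lia.
Qed.

Lemma vt_pair_gt m n : (m %% 10 == 1)%N || (m %% 10 == 7)%N -> is_unit10 n ->
  class19 n = class19 m -> (n <= m)%N -> n != m -> n != partner m -> (vt n < vt_pair m)%N.
Proof.
by rewrite /class19 /vt_pair /vt /partner => /orP[] /eqP E [] E'; rewrite E E' ?eqE //= => _; lia.
Qed.

Lemma partner_class m : is_unit10 m -> is_unit10 (partner m) -> class19 (partner m) = class19 m ->
  (m %% 10 == 1)%N || (m %% 10 == 7)%N.
Proof.
rewrite /class19 /partner => -[] E; rewrite E //= => -[] E'; rewrite E' ?eqE //= => _; lia.
Qed.

Lemma partner1 m : is_unit10 (partner m) -> (m %% 10 = 1)%N -> exists q,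
  [/\ m = 10 * q.+1 + 1, partner m = 10 * q + 9 & vt_pair m = 12 * q + 11]%N.
Proof.
rewrite /vt_pair /vt /partner => + E; rewrite E /= => un; exists (m %/ 10).-1.
have m_ge : (10 <= m)%N by case: un => E'; lia.
by split; lia.
Qed.

Lemma partner7 m : (m %% 10 = 7)%N -> exists q,
  [/\ m = 10 * q + 7, partner m = 10 * q + 3 & vt_pair m = 12 * q + 4]%N.
Proof. by rewrite /vt_pair /vt /partner => E; rewrite E /=; exists (m %/ 10)%N; split; lia. Qed.

(** The numerical comparison behind the theorem; the factor 2 arises because [wt] refers to cubes
    and [vt] to sixth powers. *)
Lemma vt_min_ltn m n : is_unit10 m -> is_unit10 n -> class19 m = ~~ class19 n ->
  (vt_min m <= 2 * wt n + (m %% 10 == 1))%N -> (m < n)%N.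
Proof.
by rewrite /class19 /vt_min /wt => -[] E [] E'; rewrite E E' ?eqE //= => _; lia.
Qed.

Section Bounds.
Variables (K : fieldType) (O : set K).
Hypothesis valO : is_valuation_ring O.
Hypothesis char2 : 2%N \in [pchar K].
Variable g : K.
Hypothesis g1 : vlt O 1 g.

Let g0 : g != 0 := vlt_neq0 valO g1.

Lemma dk_le d G n : d ^+ 16 = G ^+ 4 * d ^+ 4 + G ^+ 3 * d -> veq O G g ->
  is_unit10 n -> vle O (dk d G n ^+ 3) (g ^+ wt n).
Proof.
move=> Ed [Gg gG] un; have d3 : vle O (d ^+ 3) g by apply: (D_bound valO Ed g1 Gg).
have G0 : G != 0 by apply: (vlt_neq0 valO (vlt_le_trans valO g1 gG)).
rewrite /dk /wt exprD exprMn -exprM; apply: vleM => //.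
  by rewrite (_ : 2 * _ * 3 = 6 * (n %/ 10))%N; [apply: vleX | lia].
case: un => -> /=.
- by rewrite expr1.
- rewrite expr_div_n; apply: (vleMr_cancel (z := G ^+ 3)); first by rewrite expf_neq0.
  rewrite divfK ?expf_neq0 // -exprM (exprM _ 3 8); apply: (vle_trans valO (y := g ^+ 8)).
    exact: vleX.
  by rewrite (exprD _ 5 3); apply: vleM => //; [apply: vle_refl | apply: vleX].
- rewrite exprMn -exprM (exprM _ 3 2) (exprD _ 2 3).
  by apply: vleM => //; apply: vleX.
- rewrite exprMn -exprM (exprM _ 3 4) (exprD _ 4 3).
  by apply: vleM => //; apply: vleX.
Qed.

Variable d : K.
Hypothesis d3 : veq O (d ^+ 3) g.
Hypothesis eps2 : veq O ((d ^+ 3 + g) ^+ 2) g.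

Lemma dk_veq n : is_unit10 n -> veq O (dk d g n ^+ 6) (g ^+ vt n).
Proof.
move=> un; rewrite /dk /vt exprD exprMn -exprM; apply: veqM => //.
  by rewrite (_ : 2 * _ * 6 = 12 * (n %/ 10))%N; [apply: veq_refl | lia].
have dX m : veq O (d ^+ (3 * m)) (g ^+ m) by rewrite exprM; apply: veqX.
case: un => -> /=.
- exact: (dX 2).
- rewrite expr_div_n; apply: (veqMr_cancel (z := g ^+ 6)); first by rewrite expf_neq0.
  by rewrite divfK ?expf_neq0 // -exprM -exprD; apply: (dX 16%N).
- rewrite exprMn -exprM (exprD _ 4 6); apply: veqM => //; [exact: (dX 4) | exact: veq_refl].
- rewrite exprMn -exprM (exprD _ 8 6); apply: veqM => //; [exact: (dX 8%N) | exact: veq_refl].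
Qed.

(** The sum factors as [g^(2m+1) d (d^3 + g)]. *)
Lemma dk_pair19 m : veq O ((dk d g (10 * m.+1 + 1) + dk d g (10 * m + 9)) ^+ 6) (g ^+ (12 * m + 11)).
Proof.
rewrite /dk ?(mulnC 10) !modnMDl !divnMDl //= !addn0.
have -> : g ^+ (2 * m.+1) * d + g ^+ (2 * m) * (d ^+ 4 * g) =
    g ^+ (2 * m + 1) * (d * (d ^+ 3 + g)).
  by rewrite mulnSr !exprD; ring.
rewrite !exprMn -exprM (_ : 12 * m + 11 = (2 * m + 1) * 6 + (2 + 3))%N; last lia.
rewrite exprD; apply: veqM => //; first exact: veq_refl.
rewrite exprD; apply: veqM => //; first by rewrite (exprM _ 3 2); apply: veqX.
by rewrite (exprM _ 2 3); apply: veqX.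
Qed.

(** In characteristic 2 the sum is [g^(2m) d^2 (d^3 + g)^2 / g]. *)
Lemma dk_pair37 m : veq O ((dk d g (10 * m + 7) + dk d g (10 * m + 3)) ^+ 6) (g ^+ (12 * m + 4)).
Proof.
rewrite /dk ?(mulnC 10) !modnMDl !divnMDl //= !addn0.
have -> : g ^+ (2 * m) * (d ^+ 2 * g) + g ^+ (2 * m) * (d ^+ 8 / g) =
    g ^+ (2 * m) * (d ^+ 2 * (d ^+ 3 + g) ^+ 2) / g.
  by apply: (mulIf g0); rewrite divfK // sqrD2 // mulrDl -!mulrA mulVf //; ring.
rewrite expr_div_n; apply: (veqMr_cancel (z := g ^+ 6)); first by rewrite expf_neq0.
rewrite divfK ?expf_neq0 // -exprD !exprMn -!exprM.
rewrite (_ : 12 * m + 4 + 6 = 2 * m * 6 + (4 + 6))%N; last lia.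
rewrite (exprD g (2 * m * 6)); apply: veqM => //; first exact: veq_refl.
rewrite (exprD g 4 6); apply: veqM => //; first by rewrite -exprD (exprM _ 3 4); apply: veqX.
by rewrite -exprD (exprM _ 2 6); apply: veqX.
Qed.

Lemma veq_dominant u e (S : seq nat) : veq O (u ^+ 6) (g ^+ e) ->
  (forall n : nat, n \in S -> is_unit10 n) -> (forall n : nat, n \in S -> (vt n < e)%N) ->
  veq O ((u + \sum_(n <- S) dk d g n) ^+ 6) (g ^+ e).
Proof.
move=> ue un lt_e; apply: (veq_trans valO _ ue); apply: veqX => //; apply: veqDr => //.
have u0 : vlt O 0 u.
  move=> [c _]; rewrite mulr0 => u0; case: ue => _ [c' _ E].
  by move/eqP: E; rewrite u0 expr0n mulr0 expf_eq0 (negbTE g0) andbF.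
rewrite big_seq; elim/big_ind: _ => // [x y|n nS]; first exact: vltD.
apply: (@vltX_inv _ _ valO 6); apply: (vle_lt_trans valO (y := g ^+ vt n)).
  by case: (dk_veq (un _ nS)).
by apply: (vlt_le_trans valO (y := g ^+ e)); [apply: vlt1_exp => //; apply: lt_e | case: ue].
Qed.

(** Take out [m] and, if present, its partner: within one class all remaining terms have strictly
    smaller order, so they do not affect the leading one. *)
Lemma sum_dk_lower (S : seq nat) (m : nat) : uniq S -> m \in S ->
  (forall n : nat, n \in S -> (n <= m)%N) -> (forall n : nat, n \in S -> is_unit10 n) ->
  (forall n : nat, n \in S -> class19 n = class19 m) ->
  exists2 e, veq O ((\sum_(n <- S) dk d g n) ^+ 6) (g ^+ e) &
    (vt_min m <= e + (m %% 10 == 1))%N.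
Proof.
move=> uS mS m_max un cl; have um := un _ mS.
rewrite (perm_big _ (perm_to_rem mS)) /= big_cons.
have remE (n : nat) : (n \in rem m S) = (n != m) && (n \in S) by rewrite mem_rem_uniq.
case: (boolP (partner m \in rem m S)) => [m'S|m'nS]; last first.
  exists (vt m); last by clear -um; rewrite /vt_min /vt; case: um => -> /=; lia.
  apply: veq_dominant; first exact: dk_veq.
    by move=> n; rewrite remE => /andP[_ /un].
  move=> n nS; move: (nS); rewrite remE => /andP[ne nS'].
  case: (vt_ltn um (un _ nS') (cl _ nS') (m_max _ nS') ne) => // En.
  by rewrite -En nS in m'nS.
move: (m'S); rewrite remE => /andP[ne m'S'].
have um' := un _ m'S'; have m17 := partner_class um um' (cl _ m'S').
rewrite (perm_big _ (perm_to_rem m'S)) /= big_cons addrA.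
exists (vt_pair m); last first.
  by clear -m17; rewrite /vt_min /vt_pair /vt; case/orP: m17 => /eqP -> /=; lia.
apply: veq_dominant.
- case/orP: m17 => /eqP m10.
    have [q [-> -> ->]] := partner1 um' m10; exact: dk_pair19.
  have [q [-> -> ->]] := partner7 m10; exact: dk_pair37.
- by move=> n /mem_rem; rewrite remE => /andP[_ /un].
- move=> n; rewrite mem_rem_uniq ?rem_uniq // inE remE => /and3P[ne' ne'' nS].
  by apply: vt_pair_gt => //; [apply: un | apply: cl | apply: m_max].
Qed.
End Bounds.

(** * Residues of exponents, and conclusion *)

Lemma unit10P n : coprime n 10 -> is_unit10 n.
Proof.
rewrite -coprime_modl; have := ltn_pmod n (isT : (0 < 10)%N); rewrite /is_unit10.
by case: (n %% 10)%N => [|[|[|[|[|[|[|[|[|[|]]]]]]]]]] // _ _; constructor.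
Qed.

(** The nonzero squares modulo 5 for [true], the nonsquares for [false]. *)
Definition exp_class (b : bool) (n : nat) : bool :=
  if b then (n %% 5 == 1)%N || (n %% 5 == 4)%N else (n %% 5 == 2)%N || (n %% 5 == 3)%N.

Lemma exp_classN b n : exp_class b n -> ~~ exp_class (~~ b) n.
Proof. by rewrite /exp_class; case: b => /=; lia. Qed.

Lemma smul_support (f g : series) n : smul f g n -> exists2 i, (i <= n)%N & f i && g (n - i)%N.
Proof.
rewrite /smul => fgn; apply: contrapT => nex; move: fgn.
rewrite big1 // => i _; apply/negP => fg; apply: nex.
by exists i => //; rewrite -ltnS.
Qed.

Lemma G_support n : G n -> (5 %| n)%N.
Proof. by rewrite /G => /andP[]. Qed.

Lemma spow_G_support e n : spow G e n -> (5 %| n)%N.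
Proof.
elim: e n => [|e IH] n; first by rewrite /spow /= /sone => /eqP ->.
rewrite /spow iterS => /smul_support[i le_in /andP[/G_support di /IH dni]].
by rewrite -(subnKC le_in) dvdn_add.
Qed.

Lemma exp_classD b m n : (5 %| m)%N -> exp_class b (n + m) = exp_class b n.
Proof. by rewrite /exp_class => /dvdnP[q ->]; rewrite addnC !modnMDl. Qed.

Lemma smul_class b (f g : series) n : (forall i, f i -> exp_class b i) -> (forall i, g i -> (5 %| i)%N) ->
  smul f g n -> exp_class b n.
Proof.
move=> fb g5 /smul_support[i le_in /andP[/fb cl /g5 dv]].
by rewrite -(subnKC le_in) exp_classD.
Qed.

Lemma D_class n : D n -> exp_class true n.
Proof.
rewrite /D => /existsP[m /andP[/andP[_ c10] /eqP <-]].
have m5 : (m %% 5 != 0)%N by have [] := unit10P c10; lia.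
rewrite /exp_class -modnMml -modnMmr; move: m5; have := ltn_pmod m (isT : (0 < 5)%N).
by case: (m %% 5)%N => [|[|[|[|[|]]]]].
Qed.

Section Support.
Variable k : fieldType.
Hypothesis char2 : 2%N \in [pchar k].

(** [D^(2^a) = D(x^(2^a))], and 2 is a nonsquare modulo 5, so each doubling of the exponents
    exchanges the classes. *)
Lemma spow_D_class a n : spow D (2 ^ a) n -> exp_class (~~ odd a) n.
Proof.
rewrite (spow_frobenius char2) => /andP[/dvdnP[m ->]]; rewrite mulnK ?expn_gt0 //.
move=> /D_class; rewrite mulnC; elim: a => [|a IH]; first by rewrite mul1n.
move=> /IH; rewrite expnS -mulnA; move: (2 ^ a * m)%N => i; rewrite /exp_class.
by rewrite oddS; case: (odd a) => /=; lia.
Qed.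

Lemma divG_class b (f : series) n : (forall i, f i -> exp_class b i) -> divG f n -> exp_class b n.
Proof.
move=> fb; elim/ltn_ind: n => n IH; rewrite divGE.
case: (boolP (f _)) => [/fb cl _|_ /=]; first by rewrite -(@exp_classD b 5 n).
move=> sum1; apply: contrapT => ncl; move: sum1; rewrite big1 // => i _.
apply/negP => /andP[/(IH _ (ltn_ord i)) cl /G_support dv]; apply: ncl.
move: cl dv; have := ltn_ord i; rewrite /exp_class; case: (b) => /=; lia.
Qed.

Lemma Dk_class n i : is_unit10 n -> Dk n i -> exp_class (class19 n) i.
Proof.
move=> un /smul_support[j le_ji /andP[/spow_G_support dv]].
rewrite -[in exp_class _ i](subnK le_ji) exp_classD //; move: (i - j)%N => {le_ji}i'.
rewrite /Dbase /class19; case: un => ->; rewrite ?eqE /=.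
- exact: D_class.
- exact: (@divG_class false _ _ (@spow_D_class 3)).
- exact: (@smul_class false _ _ _ (@spow_D_class 1) G_support).
- exact: (@smul_class true _ _ _ (@spow_D_class 2) G_support).
Qed.

(** [p] is a nonsquare modulo 5, so multiplying or dividing exponents by [p] exchanges the
    classes. *)
Lemma Tp_class p n i : (p %% 10 == 3)%N || (p %% 10 == 7)%N -> is_unit10 n ->
  Tp p (Dk n) i -> exp_class (~~ class19 n) i.
Proof.
move=> p10 un; have p5 : (p %% 5 == 2)%N || (p %% 5 == 3)%N by lia.
have swap b j : exp_class b (p * j) = exp_class (~~ b) j.
  rewrite /exp_class -modnMm; have := ltn_pmod j (isT : (0 < 5)%N).
  by case/orP: p5 => /eqP ->; case: b; case: (j %% 5)%N => [|[|[|[|[|]]]]].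
rewrite /Tp; case: (boolP (Dk n (p * i)%N)) => [/(Dk_class un)|_ /= /andP[/dvdnP[j ->]]].
  by rewrite swap.
by rewrite mulnK; [move=> /(Dk_class un); rewrite mulnC swap negbK | lia].
Qed.

Lemma emb_sumD (S : seq nat) : emb k (sumD S) = \sum_(n <- S) emb k (Dk n).
Proof. by apply: psP => i; rewrite ps_sumE -natr_sumb. Qed.

Lemma ps_scale_subst (z : k) p f : (0 < p)%N -> z ^+ p = 1 -> ps_scale z (ps_subst p f) = ps_subst p f.
Proof.
move=> p0 zp; apply: psP => n; rewrite /ps_scale /ps_subst.
case: dvdnP => [[m ->]|]; last by rewrite mulr0.
by rewrite mulnC exprM zp expr1n mul1r.
Qed.

(** The sum of [z^(j n)] over [j < p] is 0 unless [p] divides [n], and then it is [p], which is 1 in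
    [k] because [p] is odd. *)
Lemma emb_Tp p (z : k) f : prime p -> odd p -> z ^+ p = 1 -> z != 1 ->
  ps_subst p (emb k (Tp p f)) =
  ps_subst p (ps_subst p (emb k f)) + \sum_(j < p) ps_scale (z ^+ j) (emb k f).
Proof.
move=> p_pr p_odd zp z1; have p0 := prime_gt0 p_pr.
have z_prim : p.-primitive_root z.
  have [m zm m_p] := prim_order_exists p0 zp.
  case/primeP: p_pr => _ /(_ _ m_p) /orP[]/eqP Em; last by rewrite -Em.
  by move: z1 (prim_expr_order zm); rewrite Em expr1 => /eqP.
apply: psP => n; rewrite psD ps_sumE; under eq_bigr => j _ do rewrite /ps_scale -exprM mulnC exprM.
rewrite -mulr_suml ps_substMn // /ps_subst /emb /Tp; case: (boolP (p %| n)%N) => [/dvdnP[m ->]|ndv].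
  rewrite mulnK // (mulnC m) dvdn_pmul2l // divnMA mulKn // natr_addb // addrC.
  rewrite (eq_bigr (fun=> 1)); last by move=> j _; rewrite exprM zp !expr1n.
  rewrite sumr_const card_ord (_ : 1 *+ p = 1) ?mul1r.
    by congr (_ + _); case: ifP.
  rewrite -(odd_double_half p) p_odd -muln2 mulrnDr mulrnA.
  by rewrite -[(1 *+ p./2) *+ 2]mulr_natr (pcharf0 char2) mulr0 addr0.
rewrite (_ : (p * p %| n)%N = false); last first.
  by apply: contraNF ndv => /(dvdn_trans (dvdn_mulr p (dvdnn p))).
rewrite add0r (_ : \sum_(j < p) _ = 0) ?mul0r //.
have zn1 : z ^+ n - 1 != 0 by rewrite subr_eq0 -(prim_order_dvd z_prim).
by apply: (mulfI zn1); rewrite mulr0 -subrX1 -exprM mulnC exprM zp expr1n subrr.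
Qed.
End Support.

(** * Places at which a given series has a pole *)

Lemma vleD_exp (K : fieldType) (O : set K) (valO : is_valuation_ring O) n x y B :
  vle O (x ^+ n) B -> vle O (y ^+ n) B -> vle O ((x + y) ^+ n) B.
Proof.
case: (vle_total valO x y) => xy xB yB.
  apply: (vle_trans valO _ yB); apply: vleX => //; apply: vleD => //; exact: vle_refl.
apply: (vle_trans valO _ xB); apply: vleX => //; apply: vleD => //; exact: vle_refl.
Qed.

(** Chevalley's theorem is applied to the ring generated by the constants and [1/f]. It does not
    contain [f]: otherwise [f] would divide a nonzero constant, although [f 0 = 0]. *)
Lemma infinite_place (k : fieldType) (f : ps k) : f != 0 -> f 0%N = 0 ->
  exists O : set {fraction ps k}, is_valuation_ring O /\ vlt O 1 (tofrac f).
Proof.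
move=> f0 f00; pose K := {fraction ps k}; pose iota : {rmorphism ps k -> K} := @tofrac (ps k).
pose d : K := iota f; have d0 : d != 0 by rewrite tofrac_eq0.
pose A0 : set K := [set x | exists c : k, x = iota (ps_const c)].
pose Rg : set K := [set x | exists h, x = iota h].
have subRg : is_subring Rg.
  split=> [|_ _ [h ->] [h' ->]|_ _ [h ->] [h' ->]].
  - by exists 1; rewrite rmorph1.
  - by exists (h - h'); rewrite rmorphB.
  - by exists (h * h'); rewrite rmorphM.
have constB (a b : k) : ps_const a - ps_const b = ps_const (a - b).
  by apply: psP => n; rewrite psD psN /ps_const; case: ifP; rewrite ?subr0.
have constM (a b : k) : ps_const a * ps_const b = ps_const (a * b).
  apply: psP => n; rewrite psM big_ord_recl big1 ?addr0.
    by rewrite subn0 /ps_const /=; case: ifP; rewrite ?mulr0.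
  by move=> i _; rewrite /ps_const /= mul0r.
have subA0 : is_subring A0.
  split=> [|_ _ [h ->] [h' ->]|_ _ [h ->] [h' ->]].
  - by exists 1; rewrite -[ps_const 1]/(1 : ps k) rmorph1.
  - by exists (h - h'); rewrite -rmorphB constB.
  - by exists (h * h'); rewrite -rmorphM constM.
have [O [valO _ nO]] : exists O : set K, [/\ is_valuation_ring O, O d^-1 & ~ O d^-1^-1].
  apply: (chevalley (adjoin_subring subA0 d^-1) (adjoin_gen subA0 _)).
  move=> [q [A0q]]; rewrite invrK => dq.
  have q0 : q != 0 by apply: contra_neq d0 => q0; rewrite dq q0 horner0.
  have [s Es] : exists s, size q = s.+1.
    by exists (size q).-1; rewrite prednK // size_poly_gt0.
  have [c Ec] : A0 q`_s := A0q s.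
  have c0 : c != 0.
    apply: contra_neq q0 => c0; apply/eqP; rewrite -lead_coef_eq0 lead_coefE Es /= Ec c0.
    by rewrite -(rmorph0 iota); apply/eqP; congr (iota _); apply: psP => n; rewrite /ps_const ps0E if_same.
  (* Multiplying [d = q(1/d)] by [d^s], with [s] the degree of [q], isolates the leading coefficient
     of [q] as [f] times the series [h]. *)
  have [h Eh] : Rg (d ^+ s - \sum_(i < s) q`_i * d ^+ (s.-1 - i)).
    apply: (subringB subRg); first by apply: (subringX subRg); exists f.
    apply: (subring_sum subRg) => i _; apply: (subringM subRg).
      by have [c' ->] := A0q i; exists (ps_const c').
    by apply: (subringX subRg); exists f.
  have E : iota (ps_const c) = iota (f * h).
    rewrite rmorphM -Eh -/d -Ec mulrBr -exprS mulr_sumr; apply/eqP; rewrite eq_sym subr_eq; apply/eqP.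
    rewrite exprSr {2}dq (horner_coef_wide _ (n := s.+1)) ?Es // mulr_sumr big_ord_recr /= addrC.
    rewrite exprVn mulrCA mulfV ?mulr1 ?expf_neq0 //; congr (_ + _); apply: eq_bigr => i _.
    rewrite exprVn mulrCA [RHS]mulrCA; congr (_ * _).
    apply: (mulIf (x := d ^+ i)); first by rewrite expf_neq0.
    by rewrite divfK ?expf_neq0 // -exprS -exprD; congr (_ ^+ _); have := ltn_ord i; lia.
  have /eqP := E; rewrite tofrac_eq => /eqP /(congr1 (fun u : ps k => u 0%N)) /eqP.
  by rewrite psM big_ord_recl big_ord0 f00 mul0r addr0 /ps_const /= (negbTE c0).
exists O; split=> // -[c Oc]; rewrite mulr1 => E; apply: nO.
by rewrite invrK -[d]/(tofrac f) E.
Qed.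

Lemma seq_max (S : seq nat) i : i \in S -> exists2 m, m \in S & forall j, j \in S -> (j <= m)%N.
Proof.
elim: S i => // a [|b S] IH i _.
  by exists a; rewrite ?mem_head // => j; rewrite inE => /eqP ->.
have [m mS m_max] := IH b (mem_head _ _); case: (leqP a m) => [le|lt].
  exists m; first by rewrite in_cons mS orbT.
  by move=> j; rewrite in_cons => /orP[/eqP ->|/m_max].
exists a; first exact: mem_head.
by move=> j; rewrite in_cons => /orP[/eqP -> //|/m_max le]; apply: leq_trans le (ltnW lt).
Qed.

(* Comparison of the two bounds at a pole of [D(x^p)] *)
Local Close Scope ring_scope.
Local Close Scope classical_set_scope.

Theorem theorem2p24 (p n : nat) (S : seq nat) :
  prime p -> (p %% 10 == 3) || (p %% 10 == 7) ->
  0 < n -> coprime n 10 ->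
  uniq S -> (forall k, k \in S -> (0 < k) && coprime k 10) ->
  Tp p (Dk n) = sumD S ->
  forall k, k \in S -> k < n.
Proof.
Local Open Scope classical_set_scope.
Local Open Scope ring_scope.
move=> p_pr p10 _ /unit10P un uS S_un TpE; have p_odd : odd p by lia.
have p0 := prime_gt0 p_pr.
have {}S_un (i : nat) : i \in S -> is_unit10 i by move=> /S_un /andP[_ /unit10P].
have [k [z [char2 zp z1]]] := exists_root_of_unity p_pr p_odd.
pose K := {fraction ps k}; pose iota : {rmorphism ps k -> K} := @tofrac (ps k).
pose psi : {rmorphism ps k -> ps k} := ps_substR k p0.
pose sub5 : {rmorphism ps k -> ps k} := ps_substR k (isT : (0 < 5)%N).
have G_sub5 : emb k G = sub5 (emb k F) by exact: emb_G.
pose d : K := iota (psi (emb k D)); pose g : K := iota (psi (emb k G)).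
have D1 : D 1 by apply/existsP; exists (Ordinal (isT : (1 < 2)%N)).
have D0 : D 0 = false by apply/existsP => -[[[|m] ?]].
have [O [valO d1]] : exists O : set K, is_valuation_ring O /\ vlt O 1 d.
  apply: infinite_place.
    apply/eqP => /(congr1 (fun f : ps k => f (p * 1)%N)) /eqP.
    by rewrite ps0E /= /ps_subst dvdn_mulr // mulKn // /emb D1 oner_eq0.
  by rewrite /= /ps_subst dvdn0 div0n /emb D0.
have chK : 2%N \in [pchar K] by exact: (K_char2 char2 iota).
have dE : d ^+ 16 = g ^+ 4 * d ^+ 4 + g ^+ 3 * d by exact: (phi_D16 char2 (iota \o psi)).
have [g1 d3 eps2] := D_large valO chK dE d1.
have Gj j : veq O (iota (ps_scale (z ^+ j) (emb k G))) g.
  have zj : (z ^+ j) ^+ p = 1 by rewrite -exprM mulnC exprM zp expr1n.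
  (* The scaling by [z ^+ j] fixes [G(x^p)], so every conjugate of [G] is compared with the same
     [g]. *)
  have E : ps_scale (z ^+ j) (ps_subst 5 (ps_subst p (emb k F))) = psi (emb k G).
    by rewrite ps_substMn // mulnC -ps_substMn // ps_scale_subst // G_sub5.
  have [H _] : (vlt O 1 (iota (ps_scale (z ^+ j) (ps_subst 5 (ps_subst p (emb k F))))) ->
      veq O (iota (ps_scale (z ^+ j) (ps_subst 5 (emb k F))))
        (iota (ps_scale (z ^+ j) (ps_subst 5 (ps_subst p (emb k F)))))) /\ _ :=
    isogeny_places char2 (iota \o ps_scale (z ^+ j) \o sub5) valO p_odd.
  by move: H; rewrite E -emb_G; apply.
have Gpp : veq O (iota (psi (psi (emb k G)))) g.
  have E : ps_subst p (ps_subst 5 (ps_subst p (emb k F))) = psi (psi (emb k G)).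
    by congr ps_subst; rewrite ps_substMn // mulnC -ps_substMn // G_sub5.
  have [] : (vlt O 1 (iota (ps_subst p (ps_subst 5 (ps_subst p (emb k F))))) ->
      veq O g (iota (ps_subst p (ps_subst 5 (ps_subst p (emb k F)))))) /\
      (vle O (iota (ps_subst p (ps_subst 5 (ps_subst p (emb k F))))) 1 -> vle O g 1).
    by rewrite /g emb_G; exact: (isogeny_places char2 (iota \o psi \o sub5) valO p_odd).
  (* Here the isogeny goes from [G(x^p)] to [G(x^(p^2))]: the latter has a pole, since otherwise [g]
     would have none. *)
  rewrite E => lt1 le1; apply: veq_sym; apply: lt1 => /le1; exact: g1.
have dk_phi (chi : {rmorphism ps k -> K}) : veq O (chi (emb k G)) g -> forall i,
    chi (emb k (Dk i)) = dk (chi (emb k D)) (chi (emb k G)) i.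
  move=> [_ gG] i; apply: phi_Dk => //.
  exact: (vlt_neq0 valO (vlt_le_trans valO g1 gG)).
have bound_phi (chi : {rmorphism ps k -> K}) : veq O (chi (emb k G)) g ->
    vle O (chi (emb k (Dk n)) ^+ 3) (g ^+ wt n).
  by move=> chiG; rewrite dk_phi //; apply: dk_le => //; apply: phi_D16.
pose h := iota (psi (emb k (Tp p (Dk n)))).
have h_le : vle O (h ^+ 3) (g ^+ wt n).
  rewrite /h /= (emb_Tp char2 _ p_pr p_odd zp z1) rmorphD rmorph_sum; apply: vleD_exp => //.
    exact: (bound_phi (iota \o psi \o psi)).
  elim/big_ind: _ => [|x y|j _]; first by rewrite expr0n; apply: vle0.
    exact: vleD_exp.
  exact: (bound_phi (iota \o ps_scale (z ^+ j)) (Gj j)).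
have sum_psi (S' : seq nat) : iota (psi (\sum_(i <- S') emb k (Dk i))) = \sum_(i <- S') dk d g i.
  rewrite !rmorph_sum; apply: eq_bigr => i _.
  exact: (dk_phi (iota \o psi) (veq_refl valO g)).
(* [S1] collects the indices in the class of [n]. Its basis elements sum to 0 by comparing exponents
   modulo 5, whereas by [sum_dk_lower] a nonempty sum is nonzero. *)
pose S1 := [seq i <- S | class19 i == class19 n].
have S1_nil : S1 = [::].
  case E1 : S1 => [//|i s1]; exfalso; have iS1 : i \in S1 by rewrite E1 mem_head.
  have [m mS m_max] := seq_max iS1.
  have S1E j : j \in S1 -> j \in S /\ class19 j = class19 n.
    by rewrite mem_filter => /andP[/eqP].
  have un1 j : j \in S1 -> is_unit10 j by move=> /S1E[/S_un].
  have cl1 j : j \in S1 -> class19 j = class19 m by move=> /S1E[_ ->]; case: (S1E _ mS).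
  have [e he _] := sum_dk_lower valO chK g1 d3 eps2 (filter_uniq _ uS) mS m_max un1 cl1.
  have sum0 : \sum_(j <- S1) emb k (Dk j) = 0.
    apply: psP => i'; rewrite ps0E ps_sumE.
    case: (boolP (exp_class (class19 n) i')) => cl; last first.
      rewrite big_seq big1 // => j /S1E[/S_un uj cj]; rewrite /emb.
      by case: (boolP (Dk j i')) => // /(Dk_class char2 uj); rewrite cj (negbTE cl).
    have : emb k (Tp p (Dk n)) i' = 0.
      rewrite /emb; case: (boolP (Tp _ _ _)) => // /(Tp_class char2 p10 un).
      by rewrite (negbTE (exp_classN cl)).
    rewrite TpE (emb_sumD char2) ps_sumE (bigID (fun j => class19 j == class19 n)) /=.
    rewrite [X in _ + X]big1_seq ?addr0 ?big_filter // => j /andP[cj jS]; rewrite /emb.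
    case: (boolP (Dk j i')) => // /(Dk_class char2 (S_un _ jS)).
    have -> : class19 j = ~~ class19 n by move: cj; case: (class19 j); case: (class19 n).
    by rewrite (negbTE (exp_classN cl)).
  move: he; rewrite -sum_psi sum0 !rmorph0 expr0n /= => -[_ [c _]] /eqP.
  by rewrite mulr0 expf_eq0 (negbTE (vlt_neq0 valO g1)) andbF.
have S_opp i : i \in S -> class19 i = ~~ class19 n.
  move=> iS; case: (eqVneq (class19 i) (class19 n)) => [ci|]; last first.
    by case: (class19 i); case: (class19 n).
  have : i \in S1 by rewrite mem_filter ci eqxx.
  by rewrite S1_nil.
move=> i iS; have [m mS m_max] := seq_max iS; apply: leq_ltn_trans (m_max _ iS) _.
have clS j : j \in S -> class19 j = class19 m by move=> jS; rewrite (S_opp _ jS) (S_opp _ mS).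
have hE : h = \sum_(j <- S) dk d g j by rewrite /h TpE (emb_sumD char2); exact: sum_psi.
have [e] := sum_dk_lower valO chK g1 d3 eps2 uS mS m_max S_un clS; rewrite -hE => he e_ge.
(* Both bounds on [h] are compared as bounds on [h ^+ 6]. *)
have e_le : (e <= 2 * wt n)%N.
  apply: (vle_exp_inv valO g1); apply: (vle_trans valO (proj2 he)).
  by rewrite (exprM _ 3 2) mulnC exprM; apply: vleX.
apply: (vt_min_ltn (S_un _ mS) un (S_opp _ mS)).
by apply: leq_trans e_ge _; rewrite leq_add2r.
Qed.
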